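(* Let $0<\alpha\le 1$, and let $A:D(A)\subset\mathbb{X}\to\mathbb{X}$ be a closed linear operator in a complex Banach space $\mathbb{X}$ that generates an exponentially stable $C_0$-semigroup $\{T(t)\}_{t\ge0}$ (i.e. there are $a,M>0$ with $\|T(t)\|\le Me^{-at}$ for all $t\ge 0$), and suppose $\{\lambda^\alpha:\operatorname{Re}\lambda>0\}\subset\rho(A)$. Assume that $e^{\Sigma_i(A,\alpha)}\setminus\{1\}$ is closed, where $e^{\Sigma_i(A,\alpha)}=\{e^{\zeta}:\zeta\in\Sigma_i(A,\alpha)\}$, and that $f\in BUC(\mathbb{R}^+,\mathbb{X})$ is asymptotic $1$-periodic, i.e. $\lim_{t\to\infty}(f(t+1)-f(t))=0$. Then the equation $D^{\alpha}_C u(t)=Au(t)+f(t)$, $t\ge0$, has an asymptotic mild solution that is asymptotic $1$-periodic if and only if it has an asymptotic mild solution (which by definition is bounded and uniformly continuous on $\mathbb{R}^+$).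
   Context: $\mathbb{R}^+=[0,\infty)$. $BUC(\mathbb{R}^+,\mathbb{X})$ is the Banach space of bounded uniformly continuous functions $\mathbb{R}^+\to\mathbb{X}$ with the sup-norm; $C_0(\mathbb{R}^+,\mathbb{X})$ is its subspace of functions tending to $0$ at infinity. A function $g\in BUC(\mathbb{R}^+,\mathbb{X})$ is asymptotic $1$-periodic if $\lim_{t\to\infty}(g(t+1)-g(t))=0$. $D^\alpha_C$ is the Caputo derivative. Powers: $\lambda^\alpha=|\lambda|^\alpha e^{i\alpha\arg\lambda}$ with $-\pi<\arg\lambda<\pi$. $\rho(A)$ is the resolvent set. $\rho(A,\alpha)$ is the set of all $\xi_0\in\mathbb{C}$ such that $\lambda^\alpha-A$ has a (bounded) inverse $(\lambda^\alpha-A)^{-1}$ that is analytic in $\lambda$ in a neighborhood of $\xi_0$; $\Sigma_i(A,\alpha):=i\mathbb{R}\setminus\rho(A,\alpha)$. For $0<\alpha<1$ let $\Phi_\alpha$ be the probability density on $(0,\infty)$ determined by $\int_0^\infty\Phi_\alpha(\theta)e^{-z\theta}\,d\theta=E_{\alpha,1}(-z)$, where $E_{\alpha,\beta}(z)=\sum_{n\ge0}\frac{z^n}{\Gamma(\alpha n+\beta)}$, and set $S_\alpha(t)=\int_0^\infty\Phi_\alpha(s)T(t^\alpha s)\,ds$, $P_\alpha(t)=\alpha\int_0^\infty s\,\Phi_\alpha(s)T(t^\alpha s)\,ds$; for $\alpha=1$, $S_1(t)=P_1(t)=T(t)$. (Thus $S_\alpha$ has Laplace transform $\lambda^{\alpha-1}(\lambda^\alpha-A)^{-1}$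 and $t^{\alpha-1}P_\alpha(t)$ has Laplace transform $(\lambda^\alpha-A)^{-1}$.) In this setting an asymptotic mild solution of $D^\alpha_Cu=Au+f$ is a function $u\in BUC(\mathbb{R}^+,\mathbb{X})$ for which there are $x\in\mathbb{X}$ (necessarily $x=u(0)$) and $\epsilon\in C_0(\mathbb{R}^+,\mathbb{X})$ with $$u(t)=S_\alpha(t)x+\int_0^t(t-s)^{\alpha-1}P_\alpha(t-s)\big(f(s)+\epsilon(s)\big)\,ds,\quad t\ge0.$$ *)

(* Defs.v *)
From HB Require Import structures.
From mathcomp Require Import all_boot all_order all_algebra.
From mathcomp Require Import complex.
From mathcomp Require Import all_classical all_reals all_analysis.

Set Implicit Arguments.
Unset Strict Implicit.
Unset Printing Implicit Defensive.

Import Order.TTheory GRing.Theory Num.Theory.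
Import numFieldNormedType.Exports.

Local Open Scope classical_set_scope.
Local Open Scope complex_scope.
Local Open Scope ring_scope.

(* The topology of the complex plane is the one of the normed module [R[i]^o]. *)
Notation Cplane R := (R[i]^o).

(* Norms over [R[i]] take (real) values in [R[i]]; [rnorm] is the same norm
   with values in [R]. *)
Definition rnorm (R : realType) (X : normedModType R[i]) (x : X) : R :=
  complex.Re `|x|.

Section ComplexFunctions.
Context {R : realType}.
Implicit Types (z : Cplane R) (alpha : R).

Definition cexp z : Cplane R :=
  (expR (complex.Re z))%:C *
    (cos (complex.Im z) +i* sin (complex.Im z)).

Definition carg z : R :=
  let theta := acos (complex.Re z / rnorm z) in
  if 0 <= complex.Im z then theta else - theta.

(* [z ^ alpha = |z| ^ alpha * exp (i alpha arg z)].  The function is total: on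
   the cut the argument is taken to be [pi], and [0 ^ alpha = 0] when
   [alpha != 0].  For [alpha = 1] it is the identity. *)
Definition cpow z alpha : Cplane R :=
  (rnorm z `^ alpha)%:C * cexp (0 +i* (alpha * carg z)).

End ComplexFunctions.

Section Bochner.
Context d (T : measurableType d) (R : realType) (X : normedModType R[i]).
Variable mu : {measure set T -> \bar R}.
Implicit Types (D : set T) (g : T -> X) (s : seq (set T * X)).

(* A list [s] of pairs (set, vector) stands for the simple function
   [\sum_((A, x) in s) \1_A x]. *)
Definition simple_eval s (t : T) : X :=
  \sum_(p <- s) (\1_(p.1) t : R)%:C *: p.2.

Definition simple_integrable D s :=
  forall p, p \in s ->
    measurable p.1 /\ (mu (D `&` p.1) < +oo)%E.

Definition simple_integral D s : X :=
  \sum_(p <- s) (fine (mu (D `&` p.1)))%:C *: p.2.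

(* [v] is the Bochner integral of [g] on [D]: [g] is approximated by
   integrable simple functions [s n] with [\int_D |g - s n| --> 0] and
   [\int_D s n --> v]. *)
Definition is_bochner_integral D g (v : X) :=
  exists s : nat -> seq (set T * X),
    [/\ forall n, simple_integrable D (s n),
        forall n, measurable_fun D
          (fun t => rnorm (g t - simple_eval (s n) t)),
        (\int[mu]_(t in D) (rnorm (g t - simple_eval (s n) t))%:E)%E
          @[n --> \oo] --> 0%E
      & simple_integral D (s n) @[n --> \oo] --> v].

Definition bochner_integrable D g := exists v, is_bochner_integral D g v.

Definition bochner_integral D g : X :=
  xget 0 [set v | is_bochner_integral D g v].

End Bochner.

Section Density.
Context {R : realType}.
Implicit Types (alpha beta z : R) (Phi : R -> R).

Definition Gamma (x : R) : R :=
  \int[lebesgue_measure]_(t in `]0, +oo[) (t `^ (x - 1) * expR (- t)).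

Definition mittag_leffler alpha beta z : R :=
  limn (series (fun n : nat => z ^+ n / Gamma (alpha * n%:R + beta))).

(* A probability density on the half-line is determined (up to a null set) by
   the values of its Laplace transform at the nonnegative reals. *)
Definition is_Phi alpha Phi :=
  [/\ measurable_fun (`]0, +oo[%classic : set R) Phi,
      forall theta, 0 < theta -> 0 <= Phi theta,
      (\int[lebesgue_measure]_(theta in `]0%R, +oo[) (Phi theta)%:E = 1)%E
    & forall z, 0 <= z ->
        (\int[lebesgue_measure]_(theta in `]0%R, +oo[)
           (Phi theta * expR (- z * theta))%:E
         = (mittag_leffler alpha 1 (- z))%:E)%E].

End Density.

Record operator (R : realType) (X : normedModType R[i]) := Operator {
  dom : set X ;
  oper :> X -> X (* meaningful on [dom] only *)
}.

Section Operators.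
Context {R : realType} {X : completeNormedModType R[i]}.
Implicit Types (A : operator X) (T : R -> {linear X -> X}) (alpha : R).

Definition linear_operator A :=
  dom A 0 /\
  forall (c : R[i]) (x y : X), dom A x -> dom A y ->
    dom A (c *: x + y) /\ A (c *: x + y) = c *: A x + A y.

Definition closed_operator A :=
  closed [set p : X * X | dom A p.1 /\ A p.1 = p.2].

Definition C0_semigroup T :=
  [/\ forall t, 0 <= t -> continuous (T t),
      forall x, T 0 x = x,
      forall s t x, 0 <= s -> 0 <= t -> T (s + t) x = T s (T t x)
    & forall x, T t x @[t --> 0^'+] --> x].

Definition generates A T :=
  forall x y, (dom A x /\ A x = y) <->
    (h^-1)%:C *: (T h x - x) @[h --> 0^'+] --> y.

Definition exponentially_stable T :=
  exists a M : R, [/\ 0 < a, 0 < M &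
    forall t x, 0 <= t -> rnorm (T t x) <= M * expR (- a * t) * rnorm x].

(* [B] is the bounded inverse of [lambda - A : dom A -> X]. *)
Definition is_resolvent A (lambda : Cplane R) (B : {linear X -> X}) :=
  [/\ continuous B,
      forall x, dom A (B x) /\ lambda *: B x - A (B x) = x
    & forall x, dom A x -> B (lambda *: x - A x) = x].

Definition resolvent_set A : set (Cplane R) :=
  [set lambda | exists B, is_resolvent A lambda B].

(* Complex differentiability in operator norm; on a neighborhood (as used in
   [rho_alpha]) it is analyticity. *)
Definition op_differentiable (B : Cplane R -> {linear X -> X})
    (lambda : Cplane R) :=
  exists2 L : {linear X -> X}, continuous L &
    forall e : R, 0 < e -> \forall mu \near lambda, forall x,
      rnorm (B mu x - B lambda x - (mu - lambda) *: L x)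
        <= e * rnorm (mu - lambda) * rnorm x.

Definition rho_alpha A alpha : set (Cplane R) :=
  [set xi | exists B : Cplane R -> {linear X -> X},
    \forall lambda \near xi,
      is_resolvent A (cpow lambda alpha) (B lambda) /\
      op_differentiable B lambda].

Definition Sigma_i A alpha : set (Cplane R) :=
  [set z | complex.Re z = 0] `\` rho_alpha A alpha.

End Operators.

(* Functions on the half-line are represented by functions on [R] whose values
   at negative reals are ignored. *)

Section HalfLine.
Context {R : realType} {X : completeNormedModType R[i]}.
Implicit Types (u f eps : R -> X).

Definition BUC u :=
  (exists M : R, forall t, 0 <= t -> rnorm (u t) <= M) /\
  (forall e : R, 0 < e -> exists2 delta : R, 0 < delta &
     forall s t, 0 <= s -> 0 <= t -> `|s - t| < delta ->
       rnorm (u s - u t) < e).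

Definition C0 u := BUC u /\ u t @[t --> +oo] --> (0 : X).

Definition asymptotic_1_periodic u :=
  u (t + 1) - u t @[t --> +oo] --> (0 : X).

Variables (alpha : R) (Phi : R -> R) (T : R -> {linear X -> X}).

Definition S_alpha (t : R) (x : X) : X :=
  if alpha == 1 then T t x else
  bochner_integral lebesgue_measure `]0, +oo[
    (fun s => (Phi s)%:C *: T (t `^ alpha * s) x).

Definition P_alpha (t : R) (x : X) : X :=
  if alpha == 1 then T t x else
  alpha%:C *: bochner_integral lebesgue_measure `]0, +oo[
    (fun s => (s * Phi s)%:C *: T (t `^ alpha * s) x).

Definition asymptotic_mild_solution f u :=
  BUC u /\
  exists (x : X) (eps : R -> X), C0 eps /\
    forall t, 0 <= t ->
      let k s := ((t - s) `^ (alpha - 1))%:C *: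
                   P_alpha (t - s) (f s + eps s) in
      bochner_integrable lebesgue_measure `[0, t] k /\
      u t = S_alpha t x + bochner_integral lebesgue_measure `[0, t] k.

End HalfLine.

(* Main.v *)
(* Exponential stability forces every asymptotic mild solution [u] to be
   asymptotic 1-periodic, so no spectral argument is needed.  With
   [K r := r ^ (alpha - 1) P_alpha(r)], Tonelli's theorem and
   [\int_0^oo alpha r ^ (alpha - 1) exp (- a s r ^ alpha) dr = 1 / (a s)] bound the
   operator norm of [K] by an integrable function [kap] with
   [\int kap <= (M / a) \int Phi_alpha].  Writing the convolution as
   [\int_0^t K r (g (t - r)) dr] with [g = f + eps], the difference
   [u (t + 1) - u t] is bounded, up to [S_alpha] terms tending to [0], by
   [\int kap r |g (t + 1 - r) - g (t - r)| dr] and a tail of [\int kap]; both tend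
   to [0] because [g] is bounded and asymptotic 1-periodic. *)
Require Import Defs.
From HB Require Import structures.
From mathcomp Require Import all_boot all_order all_algebra.
From mathcomp Require Import complex.
From mathcomp Require Import all_classical all_reals all_analysis.
From mathcomp Require Import measurable_realfun ring lra.
Import Order.TTheory GRing.Theory Num.Theory.
Import numFieldNormedType.Exports.
Local Open Scope classical_set_scope.
Local Open Scope complex_scope.
Local Open Scope ring_scope.

Set Implicit Arguments.
Unset Strict Implicit.
Unset Printing Implicit Defensive.

(** [P_alpha] is built on [bochner_integral], a total function with default value 0, so additivity
    in the vector is not automatic: estimating [K r y - K r z] requires a proof that the integrand
    of [P_alpha] is integrable. For [S_alpha] a norm bound suffices, and that bound survives the
    default. Integrability is drawn from the mass of [Phi] alone, by attaching the factor [s] to the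
    semigroup: [s T(c s) x] is bounded in [s] because [T] decays exponentially. The order of
    integration matters for the same reason. A bound on [P_alpha(r)] uniform in [r] would leave
    [r ^ (alpha - 1)], which is not integrable at infinity; integrating in [r] at fixed [s] produces
    a [1 / s] that cancels the factor [s]. The convolution is reflected so that the integrals at [t]
    and [t + 1] live on one fixed half-line and carry the same operator [K r] at each [r]; their
    difference is then estimated pointwise. *)

(** * Real-valued norms in a complex normed module *)

Section RealNorm.
Context {R : realType} {X : normedModType R[i]}.
Implicit Types (x y : X) (c : R).

Lemma normE x : `|x| = (rnorm x)%:C.
Proof. by rewrite /rnorm; have := ger0_Im (normr_ge0 x); case: `|x| => a b /= ->. Qed.

Lemma rnorm_ge0 x : 0 <= rnorm x.
Proof. by rewrite -lecR -normE normr_ge0. Qed.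

Lemma rnorm0 : rnorm (0 : X) = 0.
Proof. by rewrite /rnorm normr0. Qed.

Lemma rnormD x y : rnorm (x + y) <= rnorm x + rnorm y.
Proof. by rewrite -lecR rmorphD /= -!normE ler_normD. Qed.

Lemma rnormN x : rnorm (- x) = rnorm x.
Proof. by rewrite /rnorm normrN. Qed.

Lemma rdistC x y : rnorm (x - y) = rnorm (y - x).
Proof. by rewrite -rnormN opprB. Qed.

Lemma rnormB x y : rnorm (x - y) <= rnorm x + rnorm y.
Proof. by rewrite (le_trans (rnormD _ _))// rnormN. Qed.

Lemma rdistD z x y : rnorm (x - y) <= rnorm (x - z) + rnorm (z - y).
Proof. by rewrite (le_trans _ (rnormD _ _))// addrA subrK. Qed.

Lemma rnormZ c x : rnorm (c%:C *: x) = `|c| * rnorm x.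
Proof.
apply: (@complexI R); rewrite rmorphM /= -!normE normrZ; congr (_ * _).
by rewrite normc_def /= expr0n addr0 sqrtr_sqr.
Qed.

Lemma rnormZ_ge0 c x : 0 <= c -> rnorm (c%:C *: x) = c * rnorm x.
Proof. by move=> c0; rewrite rnormZ ger0_norm. Qed.

Lemma rnorm0_eq0 x : rnorm x = 0 -> x = 0.
Proof. by move=> x0; apply/normr0_eq0; rewrite normE x0. Qed.

(** A positive element of [R[i]] has zero imaginary part, so the complex epsilons of the norm
    topology reduce to real ones. *)
Lemma cvg_rnormP {I} (F : set_system I) {FF : Filter F} (g : I -> X) x :
  g i @[i --> F] --> x <->
  forall e : R, 0 < e -> \forall i \near F, rnorm (g i - x) < e.
Proof.
split=> [/cvgrPdist_lt gx e e0|gx].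
  have e0' : 0 < e%:C :> R[i] by rewrite ltcR.
  by near=> i; rewrite rdistC -ltcR -normE; near: i; exact: gx.
apply/cvgrPdist_lt => e; rewrite ltcE /= => /andP[/eqP eI e0].
near=> i; rewrite normE rdistC ltcE /= eI eqxx /=.
by near: i; exact: gx.
Unshelve. all: by end_near. Qed.

Lemma rnorm_cvg {I} (F : set_system I) {FF : Filter F} (g : I -> X) x :
  g i @[i --> F] --> x -> rnorm (g i) @[i --> F] --> rnorm x.
Proof.
move=> /cvg_rnormP gx; apply/cvgrPdist_lt => e e0; near=> i.
have : rnorm (g i - x) < e by near: i; exact: gx.
apply: le_lt_trans; rewrite ler_norml.
have := rnormD (g i - x) x; have := rnormD (x - g i) (g i).
by rewrite !subrK rdistC => ? ?; apply/andP; split; lra.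
Unshelve. all: by end_near. Qed.

End RealNorm.

(** * Simple functions coded by lists, and their integrals *)

Section SimpleFunctions.
Context d (T : measurableType d) (R : realType) (X : normedModType R[i]).
Variable mu : {measure set T -> \bar R}.
Implicit Types (D : set T) (g : T -> X) (s : seq (set T * X)).

Let meas_sets s := forall p, p \in s -> measurable p.1.

Lemma simple_eval_cons p s t :
  simple_eval (p :: s) t = (\1_(p.1) t : R)%:C *: p.2 + simple_eval s t.
Proof. by rewrite /simple_eval big_cons. Qed.

Lemma simple_eval_cat s s' t :
  simple_eval (s ++ s') t = simple_eval s t + simple_eval s' t.
Proof. by rewrite /simple_eval big_cat. Qed.

(** The composite is constant on finitely many measurable pieces. The induction needs [phi]
    arbitrary: on the head set it becomes [phi (x + _)]. *)
Lemma measurable_simple_comp (phi : X -> R) s :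
  meas_sets s -> measurable_fun setT (fun t => phi (simple_eval s t)).
Proof.
elim: s phi => [|[A x] s IH] phi ms.
  rewrite (_ : (fun _ => _) = cst (phi 0)); first exact: measurable_cst.
  by apply/funext => t; rewrite /simple_eval big_nil.
have mA : measurable A by apply: (ms (A, x)); rewrite mem_head.
have ms' : meas_sets s by move=> p ps; apply: ms; rewrite inE ps orbT.
rewrite (_ : (fun _ => _) = fun t => if t \in A then phi (x + simple_eval s t)
    else phi (simple_eval s t)); last first.
  apply/funext => t; rewrite simple_eval_cons /= indicE.
  by case: (t \in A); rewrite ?scale1r// scale0r add0r.
apply: measurable_fun_ifT.
- apply: (measurable_fun_bool true); rewrite (_ : _ @^-1` _ = A) ?setTI//.
  by apply/seteqP; split=> t /= => [/set_mem//|/mem_set].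
- exact: (IH (fun y => phi (x + y))).
- exact: IH.
Qed.

Definition simple_opp s : seq (set T * X) := [seq (p.1, - p.2) | p <- s].

Lemma simple_eval_opp s t : simple_eval (simple_opp s) t = - simple_eval s t.
Proof.
by rewrite /simple_eval big_map -sumrN; apply: eq_bigr => p _; rewrite scalerN.
Qed.

Lemma simple_integral_opp D s :
  simple_integral mu D (simple_opp s) = - simple_integral mu D s.
Proof.
by rewrite /simple_integral big_map -sumrN; apply: eq_bigr => p _; rewrite scalerN.
Qed.

Lemma simple_integral_cat D s s' :
  simple_integral mu D (s ++ s') = simple_integral mu D s + simple_integral mu D s'.
Proof. by rewrite /simple_integral big_cat. Qed.

Lemma simple_integrable_cat D s s' : simple_integrable mu D s ->
  simple_integrable mu D s' -> simple_integrable mu D (s ++ s').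
Proof. by move=> ? ? p; rewrite mem_cat => /orP[]; auto. Qed.

Lemma simple_integrable_opp D s : simple_integrable mu D s ->
  simple_integrable mu D (simple_opp s).
Proof. by move=> si _ /mapP[p /si [? ?] ->]. Qed.

Lemma simple_integrableS D D' s : measurable D -> measurable D' -> D `<=` D' ->
  simple_integrable mu D' s -> simple_integrable mu D s.
Proof.
move=> mD mD' DD' si p /si[mp fp]; split=> //; apply: le_lt_trans fp.
by apply: le_measure; rewrite ?inE; [exact: measurableI..|exact: setSI].
Qed.

Lemma fine_measure_split A B C : measurable A -> measurable B ->
  measurable C -> [disjoint A & B] -> (mu ((A `|` B) `&` C) < +oo)%E ->
  fine (mu ((A `|` B) `&` C)) = fine (mu (A `&` C)) + fine (mu (B `&` C)).
Proof.
move=> mA mB mC /disj_setPS AB; rewrite setIUl => fin.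
have mAC := measurableI _ _ mA mC; have mBC := measurableI _ _ mB mC.
have h : mu (A `&` C `|` B `&` C) = (mu (A `&` C) + mu (B `&` C))%E.
  apply: measureU => //; apply/seteqP; split=> // t [[At _] [Bt _]].
  by apply: AB.
rewrite h fineD//; rewrite h in fin.
- by rewrite ge0_fin_numE// (le_lt_trans _ fin)// leeDl.
- by rewrite ge0_fin_numE// (le_lt_trans _ fin)// leeDr.
Qed.

Lemma simple_integral_setU A B s : measurable A -> measurable B ->
  [disjoint A & B] -> simple_integrable mu (A `|` B) s ->
  simple_integral mu (A `|` B) s = simple_integral mu A s + simple_integral mu B s.
Proof.
move=> mA mB AB; rewrite /simple_integral -big_split /=.
elim: s => [|p s IH] si; first by rewrite !big_nil.
rewrite !big_cons IH; last by move=> q qs; apply: si; rewrite inE qs orbT.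
have [mp fp] := si p (mem_head _ _).
by rewrite fine_measure_split// rmorphD /= scalerDl.
Qed.

(* The offset [y] absorbs the first term of the list on the part of [D] where
   its indicator is 1, so that the induction splits [D]. *)
Lemma rnorm_simple_integral_offset D s y : measurable D ->
  simple_integrable mu D s -> (mu D < +oo)%E \/ y = 0 ->
  ((rnorm ((fine (mu D))%:C *: y + simple_integral mu D s))%:E <=
   \int[mu]_(t in D) (rnorm (y + simple_eval s t))%:E)%E.
Proof.
elim: s D y => [|[A x] s IH] D y mD si fin.
  rewrite /simple_integral big_nil addr0 rnormZ_ge0 ?fine_ge0//.
  under eq_integral do rewrite /simple_eval big_nil addr0.
  rewrite integral_cst//.
  case: fin => [fin|->]; last by rewrite rnorm0 mulr0 mul0e.
  by rewrite EFinM fineK ?ge0_fin_numE// muleC.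
have [/= mA fA] := si _ (mem_head _ _).
have si' : simple_integrable mu D s.
  by move=> p ps; apply: si; rewrite inE ps orbT.
have mDA : measurable (D `&` A) by exact: measurableI.
have mDA' : measurable (D `\` A) by exact: measurableD.
have dis : [disjoint D `&` A & D `\` A].
  by apply/disj_setPS => t [[_ At] [_ /(_ At)]].
have DE : D = (D `&` A) `|` (D `\` A) by rewrite setUIDK.
have ms : meas_sets ((A, x) :: s) by move=> p /si[].
have ms' : meas_sets s by move=> p /si'[].
rewrite [X in integral _ X _]DE ge0_integral_setU//; last 2 first.
- rewrite -DE; apply/measurable_EFinP; apply: measurable_funTS.
  exact: (measurable_simple_comp (fun z => rnorm (y + z))).
- by move=> t _; rewrite lee_fin rnorm_ge0.
have -> : (\int[mu]_(t in D `&` A) (rnorm (y + simple_eval ((A, x) :: s) t))%:E =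
    \int[mu]_(t in D `&` A) (rnorm ((y + x) + simple_eval s t))%:E)%E.
  apply: eq_integral => t; rewrite inE => -[_ At].
  by rewrite simple_eval_cons /= indicE mem_set//= scale1r addrA.
have -> : (\int[mu]_(t in D `\` A) (rnorm (y + simple_eval ((A, x) :: s) t))%:E =
    \int[mu]_(t in D `\` A) (rnorm (y + simple_eval s t))%:E)%E.
  apply: eq_integral => t; rewrite inE => -[_ At].
  by rewrite simple_eval_cons /= indicE memNset//= scale0r add0r.
(* The sets of a list may overlap and [D] may have infinite measure, where [fine] returns 0 and is
   no longer additive. The vector [x] joins the offset only on [D] intersected with [A], of finite
   measure; on the complement the offset is still [y]. *)
have finDA' : (mu (D `\` A) < +oo)%E \/ y = 0.
  case: fin => [fin|]; [left|by right].
  by apply: le_lt_trans fin; apply: le_measure; rewrite ?inE//; exact: subDsetl.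
apply: le_trans (leeD (IH _ (y + x) mDA _ (or_introl fA)) (IH _ y mDA' _ finDA'));
  last 2 first.
- exact: simple_integrableS si'.
- by apply: simple_integrableS si' => //; exact: subDsetl.
rewrite -EFinD lee_fin; apply: le_trans (rnormD _ _).
have -> : simple_integral mu D ((A, x) :: s) =
    (fine (mu (D `&` A)))%:C *: x + simple_integral mu D s.
  by rewrite /simple_integral big_cons.
rewrite [in X in simple_integral mu X s]DE simple_integral_setU -?DE//.
have -> : (fine (mu D))%:C *: y =
    (fine (mu (D `&` A)))%:C *: y + (fine (mu (D `\` A)))%:C *: y.
  case: fin => [fin|->]; last by rewrite !scaler0 addr0.
  have := @fine_measure_split (D `&` A) (D `\` A) setT mDA mDA' measurableT dis.
  by rewrite !setIT -DE => ->//; rewrite rmorphD /= scalerDl.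
rewrite scalerDr le_eqVlt; apply/orP; left; apply/eqP; congr rnorm.
rewrite -!addrA; congr (_ + _).
by rewrite [LHS]addrCA [in LHS](addrCA _ (simple_integral _ _ _)).
Qed.

Lemma rnorm_simple_integral D s : measurable D -> simple_integrable mu D s ->
  ((rnorm (simple_integral mu D s))%:E <=
   \int[mu]_(t in D) (rnorm (simple_eval s t))%:E)%E.
Proof.
move=> mD si.
have := @rnorm_simple_integral_offset D s 0 mD si (or_intror erefl).
by rewrite scaler0 add0r; under eq_integral do rewrite add0r.
Qed.

Lemma measurable_simple_dist D s s' : meas_sets s -> meas_sets s' ->
  measurable_fun D (fun t => rnorm (simple_eval s t - simple_eval s' t)).
Proof.
move=> ms ms'; apply: measurable_funTS.
apply: (eq_measurable_fun (fun t => rnorm (simple_eval (s ++ simple_opp s') t))).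
  by move=> t _; rewrite simple_eval_cat simple_eval_opp.
apply: (@measurable_simple_comp (fun z => rnorm z)) => p.
by rewrite mem_cat => /orP[/ms//|/mapP[q /ms' ? ->//]].
Qed.

Lemma rdist_simple_integral D s s' : measurable D ->
  simple_integrable mu D s -> simple_integrable mu D s' ->
  ((rnorm (simple_integral mu D s - simple_integral mu D s'))%:E <=
   \int[mu]_(t in D) (rnorm (simple_eval s t - simple_eval s' t))%:E)%E.
Proof.
move=> mD si si'; rewrite -simple_integral_opp -simple_integral_cat.
under eq_integral do rewrite -simple_eval_opp -simple_eval_cat.
apply: rnorm_simple_integral => //.
by apply: simple_integrable_cat => //; exact: simple_integrable_opp.
Qed.

End SimpleFunctions.

(** An eventual real bound forces finiteness, which reduces the convergence to that of the [fine]
    values. *)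
Lemma ge0_cvge0P {R : realType} {I} (F : set_system I) {FF : Filter F}
    (a : I -> \bar R) : (forall i, 0 <= a i)%E ->
  a i @[i --> F] --> 0%E <->
  forall e : R, 0 < e -> \forall i \near F, (a i <= e%:E)%E.
Proof.
move=> a0; split=> [/fine_cvgP[fa /cvgrPdist_le a_0] e e0|ae].
  near=> i; have fi : a i \is a fin_num by near: i; exact: fa.
  rewrite -(fineK fi) lee_fin.
  have : `|0 - fine (a i)| <= e by near: i; exact: a_0.
  by rewrite sub0r normrN ger0_norm// fine_ge0.
have fa e : 0 < e -> \forall i \near F, a i \is a fin_num /\ fine (a i) <= e.
  move=> e0; near=> i; have ai : (a i <= e%:E)%E by near: i; exact: ae.
  have fi : a i \is a fin_num by rewrite ge0_fin_numE// (le_lt_trans ai)// ltry.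
  by split=> //; rewrite -lee_fin fineK.
apply/fine_cvgP; split; first by near=> i; have [] : a i \is a fin_num /\
  fine (a i) <= 1 by near: i; exact: fa.
apply/cvgrPdist_le => e e0; near=> i.
rewrite sub0r normrN ger0_norm ?fine_ge0//.
by have [] : a i \is a fin_num /\ fine (a i) <= e by near: i; exact: fa.
Unshelve. all: by end_near. Qed.

(** * Bochner integral: difference estimate, uniqueness, integrability by domination *)

Section BochnerIntegral.
Context d (T : measurableType d) (R : realType) (X : normedModType R[i]).
Variable mu : {measure set T -> \bar R}.
Implicit Types (D : set T) (g : T -> X) (h : T -> \bar R).

(* A Bochner integrable function need not be Borel measurable on a null set, so
   its norm may fail to be measurable; bounds therefore go through a measurable
   majorant [h]. *)
Lemma is_bochner_integral_rdist_le D g g' v v' h : measurable D ->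
  is_bochner_integral mu D g v -> is_bochner_integral mu D g' v' ->
  measurable_fun D h ->
  (forall t, D t -> (rnorm (g t - g' t))%:E <= h t)%E ->
  ((rnorm (v - v'))%:E <= \int[mu]_(t in D) h t)%E.
Proof.
move=> mD [s [si ms ds cs]] [s' [si' ms' ds' cs']] mh gh.
have h0 t : D t -> (0 <= h t)%E.
  by move=> Dt; apply: le_trans (gh t Dt); rewrite lee_fin rnorm_ge0.
pose a n := (\int[mu]_(t in D) (rnorm (g t - simple_eval (s n) t))%:E)%E.
pose b n := (\int[mu]_(t in D) (rnorm (g' t - simple_eval (s' n) t))%:E)%E.
have a0 n : (0 <= a n)%E by apply: integral_ge0 => t _; rewrite lee_fin rnorm_ge0.
have b0 n : (0 <= b n)%E by apply: integral_ge0 => t _; rewrite lee_fin rnorm_ge0.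
(* Pointwise, the distance of the two simple functions is at most their distances to [g] and [g']
   plus [h]; each of these three majorants is measurable even if [g - g'] has a non-measurable
   norm. *)
have key n : ((rnorm (simple_integral mu D (s n) - simple_integral mu D (s' n)))%:E
    <= a n + b n + \int[mu]_(t in D) h t)%E.
  apply: (le_trans (rdist_simple_integral mD (si n) (si' n))).
  have mE1 := ms n; have mE2 := ms' n.
  rewrite /a /b -ge0_integralD//; first last.
  - exact/measurable_EFinP.
  - by move=> t _; rewrite lee_fin rnorm_ge0.
  - exact/measurable_EFinP.
  - by move=> t _; rewrite lee_fin rnorm_ge0.
  rewrite -ge0_integralD//; first last.
  - by apply: emeasurable_funD; exact/measurable_EFinP.
  - by move=> t _; rewrite -EFinD lee_fin addr_ge0// rnorm_ge0.
  apply: ge0_le_integral => //.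
  - by move=> t _; rewrite lee_fin rnorm_ge0.
  - by apply/measurable_EFinP/measurable_simple_dist => p; [move=> /si[]|move=> /si'[]].
  - by apply: emeasurable_funD => //; apply: emeasurable_funD; exact/measurable_EFinP.
  - move=> t Dt; apply: le_trans (leeD2l _ (gh t Dt)).
    rewrite -!EFinD lee_fin.
    apply: (le_trans (rdistD (g t) _ _)); rewrite rdistC -addrA lerD2l.
    by apply: (le_trans (rdistD (g' t) _ _)); rewrite addrC.
apply/lee_addgt0Pr => e e0.
(* Four errors: the two simple integrals against [v] and [v'], and the two integrated distances
   [a n] and [b n]. *)
have e4 : 0 < e / 4 by rewrite divr_gt0.
have /ge0_cvge0P-/(_ a0) := ds; have /ge0_cvge0P-/(_ b0) := ds'.
move: cs cs' => /cvg_rnormP/(_ _ e4) cs /cvg_rnormP/(_ _ e4) cs' /(_ _ e4) bs /(_ _ e4) as_.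
have [n [[[csn cs'n] bn] an]] := filter_ex
  (filterI (filterI (filterI cs cs') bs) as_).
have : ((rnorm (v - v'))%:E <= (e / 4 + e / 4)%:E + (a n + b n + \int[mu]_(t in D) h t))%E.
  apply: (le_trans _ (leeD2l _ (key n))); rewrite -EFinD lee_fin.
  apply: (le_trans (rdistD (simple_integral mu D (s n)) _ _)).
  rewrite -addrA lerD//; first by rewrite rdistC ltW.
  by apply: (le_trans (rdistD (simple_integral mu D (s' n)) _ _)); rewrite [leRHS]addrC lerD2l ltW.
move=> /le_trans; apply; rewrite addeA [leRHS]addeC leeD2r//.
apply: (@le_trans _ _ ((e / 4 + e / 4)%:E + ((e / 4)%:E + (e / 4)%:E))%E).
  by rewrite leeD2l// leeD.
by rewrite -!EFinD lee_fin; lra.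
Qed.

Lemma is_bochner_integral0 D : is_bochner_integral mu D (cst 0 : T -> X) 0.
Proof.
exists (fun=> [::]); split=> //.
- move=> n; apply: (eq_measurable_fun (cst (0 : R))); last exact: measurable_cst.
  by move=> t _; rewrite /= /simple_eval big_nil subr0 rnorm0.
- rewrite (_ : (fun=> _) = cst 0%E); first exact: cvg_cst.
  apply/funext => n; apply: integral0_eq => t _.
  by rewrite /simple_eval big_nil subr0 rnorm0.
- rewrite (_ : (fun=> _) = cst 0); first exact: cvg_cst.
  by apply/funext => n; rewrite /simple_integral big_nil.
Qed.

Lemma is_bochner_integral_unique D g v v' : measurable D ->
  is_bochner_integral mu D g v -> is_bochner_integral mu D g v' -> v = v'.
Proof.
move=> mD gv gv'; apply/eqP; rewrite -subr_eq0; apply/eqP/rnorm0_eq0/eqP.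
rewrite eq_le rnorm_ge0 andbT -lee_fin.
have -> : (0%:E = \int[mu]_(t in D) 0)%E by rewrite integral0.
apply: (is_bochner_integral_rdist_le mD gv gv'); first exact: measurable_cst.
by move=> t _; rewrite subrr rnorm0.
Qed.

Lemma bochner_integralP D g : bochner_integrable mu D g ->
  is_bochner_integral mu D g (bochner_integral mu D g).
Proof. by move=> /cid[v gv]; exact: (@xgetPex _ 0 [set v | _] (ex_intro _ v gv)). Qed.

Lemma bochner_integralE D g v : measurable D ->
  is_bochner_integral mu D g v -> bochner_integral mu D g = v.
Proof.
move=> mD gv; apply: (is_bochner_integral_unique mD _ gv).
by apply: bochner_integralP; exists v.
Qed.

(** An integrable [g] is compared with the zero function; for any other [g] the integral is the
    default 0 and the bound is trivial. Hence [S_alpha] can be bounded without discussing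
    integrability. *)
Lemma rnorm_bochner_integral_le D g h : measurable D -> measurable_fun D h ->
  (forall t, D t -> (rnorm (g t))%:E <= h t)%E ->
  ((rnorm (bochner_integral mu D g))%:E <= \int[mu]_(t in D) h t)%E.
Proof.
move=> mD mh gh.
have h0 t : D t -> (0 <= h t)%E.
  by move=> Dt; apply: le_trans (gh t Dt); rewrite lee_fin rnorm_ge0.
have [gi|/forallNP gn] := pselect (bochner_integrable mu D g).
  rewrite -[bochner_integral _ _ _]subr0.
  apply: (is_bochner_integral_rdist_le mD (bochner_integralP gi)
    (is_bochner_integral0 D)) => //.
  by move=> t Dt; rewrite subr0 gh.
rewrite /bochner_integral xgetPN; last by move=> v; exact: gn.
by rewrite rnorm0 integral_ge0.
Qed.

End BochnerIntegral.

(** Scalar dominated convergence, with majorant [2 h], makes the integral of [|g - s n|] tend to 0.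
    The simple integrals are then Cauchy, and completeness of [X] supplies the value of the
    integral. *)
Lemma dominated_bochner_integrable d (T : measurableType d) (R : realType)
    (X : completeNormedModType R[i]) (mu : {measure set T -> \bar R})
    (D : set T) (g : T -> X) (s : nat -> seq (set T * X)) (h : T -> \bar R) :
  measurable D -> (forall n, simple_integrable mu D (s n)) ->
  (forall t, D t -> simple_eval (s n) t @[n --> \oo] --> g t) ->
  mu.-integrable D h ->
  (forall n t, D t -> (rnorm (simple_eval (s n) t))%:E <= h t)%E ->
  bochner_integrable mu D g.
Proof.
move=> mD si sg hi sh.
have ms n : forall p, p \in s n -> measurable p.1 by move=> p /si[].
have dsg n t : D t -> rnorm (simple_eval (s m) t - simple_eval (s n) t) @[m --> \oo]
    --> rnorm (g t - simple_eval (s n) t).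
  by move=> Dt; apply: rnorm_cvg; apply: cvgB; [exact: sg|exact: cvg_cst].
(* With [n] fixed, this is a pointwise limit in [m] of distances between simple functions, which are
   measurable. *)
have mgs n : measurable_fun D (fun t => rnorm (g t - simple_eval (s n) t)).
  apply: (@measurable_fun_cvg _ _ _ _
    (fun m t => rnorm (simple_eval (s m) t - simple_eval (s n) t))); last exact: dsg.
  by move=> m; exact: measurable_simple_dist (ms m) (ms n).
pose a n := (\int[mu]_(t in D) (rnorm (g t - simple_eval (s n) t))%:E)%E.
have a_0 : a n @[n --> \oo] --> 0%E.
  pose f_ n t := (rnorm (g t - simple_eval (s n) t))%:E.
  have mf_ n : measurable_fun D (f_ n) by exact/measurable_EFinP.
  have f_0 : {ae mu, forall t, D t -> f_ n t @[n --> \oo] --> cst 0%E t}.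
    apply: aeW => t Dt; apply: cvg_EFin; first exact: nearW.
    rewrite -(@rnorm0 R X) -(subrr (g t)).
    by apply: rnorm_cvg; apply: cvgB; [exact: cvg_cst|exact: sg].
  have f_h : {ae mu, forall t n, D t -> (`|f_ n t| <= 2%:E * h t)%E}.
    apply: aeW => t n Dt; rewrite gee0_abs ?lee_fin ?rnorm_ge0//.
    have gth : ((rnorm (g t))%:E <= h t)%E.
      have ht0 : (0 <= h t)%E.
        by apply: (le_trans _ (sh 0%N _ Dt)); rewrite lee_fin rnorm_ge0.
      move: ht0 (fun m => sh m t Dt); case: (h t) => [r| |]//= _ sr; last by rewrite leey.
      rewrite lee_fin.
      apply: (cvgr_to_le (rnorm_cvg (sg t Dt))).
      by apply: nearW => m; rewrite -lee_fin.
    rewrite mule_natl mule2n; apply: (le_trans _ (leeD gth (sh n t Dt))).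
    by rewrite -EFinD lee_fin rnormB.
  have [] := dominated_convergence mD mf_ (@measurable_cst _ _ _ _ _ _) f_0
    (integrableZl mD 2 hi) f_h.
  by rewrite integral0.
have a0 n : (0 <= a n)%E by apply: integral_ge0 => t _; rewrite lee_fin rnorm_ge0.
have Ia m n : ((rnorm (simple_integral mu D (s m) - simple_integral mu D (s n)))%:E <=
    a m + a n)%E.
  apply: (le_trans (rdist_simple_integral mD (si m) (si n))).
  rewrite /a -ge0_integralD//; first last.
  - exact/measurable_EFinP.
  - by move=> t _; rewrite lee_fin rnorm_ge0.
  - exact/measurable_EFinP.
  - by move=> t _; rewrite lee_fin rnorm_ge0.
  apply: ge0_le_integral => //.
  - by move=> t _; rewrite lee_fin rnorm_ge0.
  - exact/measurable_EFinP/(measurable_simple_dist (ms m) (ms n)).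
  - by apply: emeasurable_funD; exact/measurable_EFinP.
  - move=> t Dt; rewrite -EFinD lee_fin.
    by apply: (le_trans (rdistD (g t) _ _)); rewrite rdistC.
have cI : cvgn (fun n => simple_integral mu D (s n)).
  apply: cauchy_cvg; apply/cauchyP => e; rewrite ltcE /= => /andP[/eqP eI e0].
  have /ge0_cvge0P-/(_ a0) := a_0.
  have e4 : 0 < complex.Re e / 4 by rewrite divr_gt0.
  move=> /(_ _ e4) an.
  have [N _ Nan] := an.
  exists (simple_integral mu D (s N)); near=> n.
  rewrite -ball_normE /= normE ltcE /= eI eqxx /=.
  have nN : (N <= n)%N by near: n; exists N.
  have := le_trans (Ia N n) (leeD (Nan N (leqnn N)) (Nan n nN)).
  by rewrite -EFinD lee_fin => /le_lt_trans; apply; lra.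
by exists (limn (fun n => simple_integral mu D (s n))), s; split.
Unshelve. all: by end_near. Qed.

(** * Integrability of a scalar density times a left-continuous vector function *)

Section GridApproximation.
Context {R : realType} {X : completeNormedModType R[i]}.
Variables (phi : R -> R) (y : R -> X).
Notation D := (`]0, +oo[%classic : set R).
Notation mu := (@lebesgue_measure R).

Let cell m k : set R := `[k%:R / m.+1%:R, k.+1%:R / m.+1%:R[%classic.

Let node m (t : R) : R := (Num.truncn (t * m.+1%:R))%:R / m.+1%:R.

(** Both [t] and [phi t] are rounded down to multiples of [1 / (m + 1)]. Rounding [phi] down keeps
    the approximation below the majorant, and rounding [t] down calls for continuity of [y] from the
    left only. The [(m + 1) ^ 2] indices in each direction cover exactly the values below
    [m + 1]. *)
Let grid m : seq (set (measurableTypeR R) * X) :=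
  [seq (D `&` (cell m p.1 `&` phi @^-1` cell m p.2),
        (p.2%:R / m.+1%:R : R)%:C *: y (p.1%:R / m.+1%:R))
  | p <- [seq (k, j) | k <- iota 0 (m.+1 * m.+1), j <- iota 0 (m.+1 * m.+1)]].

Let cellE m k t : 0 <= t -> cell m k t = (Num.truncn (t * m.+1%:R) == k) :> Prop.
Proof.
move=> t0; rewrite /cell /= in_itv /= ler_pdivrMr// ltr_pdivlMr//.
apply/propeqP; split=> [|/eqP <-]; first by move/truncn_def => ->.
by apply: truncn_itv; rewrite mulr_ge0.
Qed.

Let node_itv m t : 0 <= t -> node m t <= t < node m t + m.+1%:R^-1.
Proof.
move=> t0; rewrite -[in X in _ < X](mul1r (_^-1)) -mulrDl natr1.
rewrite ler_pdivrMr// ltr_pdivlMr//.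
by apply: truncn_itv; rewrite mulr_ge0.
Qed.

Let node_ge0 m t : 0 <= node m t.
Proof. by rewrite divr_ge0. Qed.

(** The cells are disjoint: only the pair of truncations [(k, j)] can contribute, and it is listed
    exactly when [t] and [phi t] are below [m + 1]. *)
Let grid_eval m (t : measurableTypeR R) : D t -> 0 <= phi t ->
  simple_eval (grid m) t =
  if (t < m.+1%:R) && (phi t < m.+1%:R) then (node m (phi t))%:C *: y (node m t)
  else 0.
Proof.
move=> Dt phi0; have t0 : 0 <= t by move: Dt; rewrite /= in_itv /= andbT => /ltW.
pose k := Num.truncn (t * m.+1%:R); pose j := Num.truncn (phi t * m.+1%:R).
have rangeE x : 0 <= x -> (Num.truncn (x * m.+1%:R) < m.+1 * m.+1)%N = (x < m.+1%:R).
  by move=> x0; rewrite truncn_lt_nat ?mulr_ge0// natrM ltr_pM2r.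
pose v (p : nat * nat) : X := (p.2%:R / m.+1%:R : R)%:C *: y (p.1%:R / m.+1%:R).
have eval p : (\1_(D `&` (cell m p.1 `&` phi @^-1` cell m p.2)) t : R)%:C *: v p =
    if p == (k, j) then v p else 0.
  rewrite indicE; case: eqP => [->|pE].
    rewrite mem_set ?scale1r//; split=> //; split; rewrite /preimage/= -/(cell _ _ _);
      by rewrite cellE.
  rewrite memNset ?scale0r//= => -[_ [kt jt]]; apply: pE.
  move: kt jt; rewrite /preimage /= -!/(cell _ _ _) !cellE// => /eqP kE /eqP jE.
  by rewrite [p]surjective_pairing -kE -jE.
rewrite /simple_eval /grid big_map (eq_bigr _ (fun p _ => eval p)).
have mem : ((k, j) \in [seq (k, j) | k <- iota 0 (m.+1 * m.+1),
    j <- iota 0 (m.+1 * m.+1)]) = (t < m.+1%:R) && (phi t < m.+1%:R).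
  rewrite -rangeE// -[in RHS]rangeE// -/k -/j.
  apply/allpairsP/andP => [[[a b] [+ + [-> ->]]]|[ka jb]].
    by rewrite !mem_iota.
  by exists (k, j); split; rewrite // mem_iota.
case: ifP => [|/negbT]; rewrite -mem => kj.
  rewrite (bigD1_seq (k, j))//; last first.
  by apply: allpairs_uniq; rewrite ?iota_uniq// => -[? ?] [? ?].
  by rewrite /= eqxx big1 ?addr0// => p /negbTE ->.
rewrite big1_seq// => p /andP[_ ps]; case: eqP => // pE.
by move: kj; rewrite -pE ps.
Qed.

(** Domination along [grid] with majorant [C phi]. The error splits into the rounding of [phi],
    controlled by [C], and the variation of [y] between the node and [t], weighted by [phi t]. *)
Lemma bochner_integrable_scale (C : R) :
  measurable_fun D phi -> (forall t, 0 < t -> 0 <= phi t) ->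
  mu.-integrable D (EFin \o phi) ->
  (forall t, 0 <= t -> rnorm (y t) <= C) ->
  (forall t e : R, 0 < t -> 0 < e -> exists2 delta, 0 < delta &
    forall s, 0 <= s -> s <= t -> t - s < delta -> rnorm (y s - y t) < e) ->
  bochner_integrable mu D (fun t => (phi t)%:C *: y t).
Proof.
move=> mphi phi0 iphi yC ycont.
have C0 : 0 <= C by apply: le_trans (yC 0 (lexx _)); exact: rnorm_ge0.
have D0 t : D t -> 0 < t by rewrite /= in_itv /= andbT.
have mD : measurable D by [].
have mcell m k : measurable (cell m k) by exact: measurable_itv.
apply: (@dominated_bochner_integrable _ (measurableTypeR R) R X mu D _ grid
  (fun t => C%:E * (phi t)%:E)%E) => //.
- move=> n _ /mapP[p _ ->] /=.
  have mA : measurable (D `&` (cell n p.1 `&` phi @^-1` cell n p.2)).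
    by rewrite setICA; apply: measurableI => //; exact: mphi.
  split=> //.
  apply: (@le_lt_trans _ _ (mu (cell n p.1))).
    apply: le_measure; rewrite ?inE.
    - exact: (measurableI D _ mD mA).
    - exact: mcell.
    - by move=> t [_ [_ []]].
  have := @lebesgue_measure_itv R `[p.1%:R / n.+1%:R, p.1.+1%:R / n.+1%:R[.
  by rewrite /= => ->; case: ifP => _; rewrite -?EFinD ltry.
- move=> t Dt; have t0 := D0 _ Dt; have pt0 := phi0 _ t0.
  apply/cvg_rnormP => e e0.
  (* The [+ 1] keeps the denominator positive when [phi t = 0]; below, [C + 1] serves the same
     end. *)
  have [d d0 yd] := ycont t (e / (2 * (phi t + 1))) t0 ltac:(by
    rewrite divr_gt0// mulr_gt0// ltr_wpDl).
  have inv0 (r : R) : 0 < r -> \forall n \near \oo, n.+1%:R^-1 < r.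
    by move=> r0; exact: near_infty_natSinv_lt (PosNum r0).
  have big (r : R) : \forall n \near \oo, r < n.+1%:R.
    near=> n; apply: (@lt_le_trans _ _ n%:R); last by rewrite ler_nat.
    by near: n; exact: nbhs_infty_gtr.
  near=> n; rewrite grid_eval//.
  have -> : (t < n.+1%:R) && (phi t < n.+1%:R).
    by apply/andP; split; near: n; exact: big.
  have /andP[nt1 nt2] := node_itv n (ltW t0).
  have /andP[np1 np2] := node_itv n pt0.
  have n0 : 0 <= n.+1%:R^-1 :> R by rewrite invr_ge0.
  have n1 : n.+1%:R^-1 < d by near: n; exact: inv0.
  have n2 : n.+1%:R^-1 < e / (2 * (C + 1)).
    by near: n; apply: inv0; rewrite divr_gt0// mulr_gt0// ltr_wpDl.
  have -> : (node n (phi t))%:C *: y (node n t) - (phi t)%:C *: y t =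
      (node n (phi t) - phi t)%:C *: y (node n t) +
      (phi t)%:C *: (y (node n t) - y t).
    by rewrite rmorphB /= scalerBl scalerBr addrA subrK.
  apply: (le_lt_trans (rnormD _ _)); rewrite !rnormZ (ger0_norm pt0).
  rewrite [ltRHS](splitr e); apply: ltrD.
    apply: (@le_lt_trans _ _ (n.+1%:R^-1 * C)).
      apply: ler_pM => //; [exact: rnorm_ge0| |exact: yC].
      by move: n0 np1 np2; move: (node _ _) (_^-1) => a b *; rewrite ler_norml; apply/andP; split; lra.
    apply: (@le_lt_trans _ _ (e / (2 * (C + 1)) * C)).
      by rewrite ler_wpM2r// ltW.
    rewrite invfM mulrA -mulrA gtr_pMr ?divr_gt0//.
    by rewrite mulrC ltr_pdivrMr ?ltr_wpDl// mul1r ltrDl.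
  apply: (@le_lt_trans _ _ (phi t * (e / (2 * (phi t + 1))))).
    by rewrite ler_wpM2l// ltW// yd// ltrBlDl (lt_trans nt2)// ltrD2l.
  rewrite (_ : phi t * _ = e / 2 * (phi t / (phi t + 1))); last by rewrite invfM; ring.
  rewrite gtr_pMr ?divr_gt0//.
  by rewrite ltr_pdivrMr ?ltr_wpDl// mul1r ltrDl.
- exact: integrableZl.
- move=> n t Dt; have t0 := D0 _ Dt; have pt0 := phi0 _ t0.
  rewrite grid_eval// -EFinM lee_fin; case: ifP => _; last first.
    by rewrite rnorm0 mulr_ge0.
  rewrite rnormZ_ge0// mulrC ler_pM ?rnorm_ge0 ?yC//.
  by have /andP[] := node_itv n pt0.
Unshelve. all: by end_near. Qed.

End GridApproximation.

(** * Invariance of both integrals under [r |-> t - r] *)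

Section Reflection.
Context {R : realType}.
Notation mu := (@lebesgue_measure R).

Definition reflect_at (t r : measurableTypeR R) : measurableTypeR R := t - r.

Lemma measurable_reflect_at t : measurable_fun setT (reflect_at t).
Proof. by apply: measurable_funB => //; exact: measurable_cst. Qed.

HB.instance Definition _ t := isMeasurableFun.Build _ _ (measurableTypeR R)
  (measurableTypeR R) (reflect_at t) (measurable_reflect_at t).

(** By uniqueness of Lebesgue measure it is enough to treat []a, b]], whose preimage is [[t - b, t -
    a[]: the closed end changes side but the length is kept. *)
Lemma lebesgue_measure_reflect t A : measurable A ->
  mu (reflect_at t @^-1` A) = mu A.
Proof.
move=> mA; rewrite -[LHS]/(pushforward mu (reflect_at t) A).
apply/esym/lebesgue_measure_unique => //= _ [[a b]] _ <-.
rewrite /pushforward (_ : _ @^-1` _ = `[t - b, t - a[%classic); last first.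
  apply/seteqP; split=> r; rewrite /= /reflect_at !in_itv /= => /andP[? ?];
    by apply/andP; split; lra.
rewrite !lebesgue_measure_itv /= !lte_fin ltrD2l ltrN2.
by case: ifP => // _; rewrite -!EFinB; congr (_%:E); lra.
Qed.

Lemma ge0_integral_reflect t D (f : R -> \bar R) : measurable D ->
  measurable_fun D f -> (forall r, D r -> 0 <= f r)%E ->
  (\int[mu]_(r in reflect_at t @^-1` D) f (t - r)%R = \int[mu]_(r in D) f r)%E.
Proof.
move=> mD mf f0.
rewrite -(@ge0_integral_pushforward _ _ _ _ _ _ (measurable_reflect_at t) mu D f)//; last first.
  by move=> r; rewrite inE; exact: f0.
by apply: eq_measure_integral => A mA _; exact: lebesgue_measure_reflect.
Qed.

(** Extending by 0 beyond [t] makes the domain independent of [t], so that convolutions at different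
    times can be subtracted. The approximating lists are transported by taking preimages of their
    sets cut down to [[0, t]], an interval that is its own mirror image. *)
Lemma is_bochner_integral_reflect (X : completeNormedModType R[i]) (t : R)
    (g : R -> X) (v : X) :
  is_bochner_integral mu `[0, t]%classic g v ->
  is_bochner_integral mu `[0, +oo[%classic
    (fun r => if r <= t then g (t - r) else 0) v.
Proof.
move=> [s [si ms ds cs]].
pose I : set (measurableTypeR R) := `[0, t]%classic.
have mI : measurable I by exact: measurable_itv.
pose H : set (measurableTypeR R) := `[0, +oo[%classic.
have mH : measurable H by exact: measurable_itv.
have IE r : (r \in I) = (0 <= r <= t) by apply/idP/idP; rewrite inE /I /= in_itv.
have rI : reflect_at t @^-1` I = I.
  apply/seteqP; split=> r; rewrite /I /= /reflect_at !in_itv /= => /andP[? ?];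
    by apply/andP; split; lra.
pose s' n := [seq (reflect_at t @^-1` (I `&` p.1), p.2) | p <- s n].
have mrI A : measurable A -> measurable (reflect_at t @^-1` (I `&` A)).
  move=> mA; rewrite -[_ @^-1` _]setTI.
  by apply: measurable_reflect_at => //; exact: measurableI.
have HrI A : H `&` reflect_at t @^-1` (I `&` A) = reflect_at t @^-1` (I `&` A).
  apply/setIidr => r [+ _]; rewrite /I /H /= /reflect_at !in_itv /= => /andP[_ ?].
  by rewrite andbT; lra.
have eval n r : simple_eval (s' n) r =
    if r \in I then simple_eval (s n) (t - r) else 0.
  rewrite /simple_eval big_map; case: ifPn => [rI'|rI'].
    apply: eq_bigr => p _; rewrite !indicE; congr ((_ : R)%:C *: _).
    congr (nat_of_bool _)%:R; apply/idP/idP; rewrite !inE; first by case.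
    by move=> pr; split=> //; have := rI'; rewrite -[in X in X -> _]rI inE.
  apply: big1_seq => p _; rewrite indicE memNset ?scale0r// => -[+ _].
  by rewrite -[I _]/((reflect_at t @^-1` I) r) rI => /mem_set; rewrite (negbTE rI').
(* Cut off outside [[0, t]], the error is measurable on the whole line and can be composed with the
   reflection. *)
pose F n := (fun r => rnorm (g r - simple_eval (s n) r)) \_ I.
have mF n : measurable_fun setT (F n) by apply/(measurable_restrictT _ mI); exact: ms.
have FE n r : H r -> rnorm ((if r <= t then g (t - r) else 0) - simple_eval (s' n) r)
    = F n (t - r).
  rewrite /H /= in_itv /= andbT => r0; rewrite eval /F /patch !IE r0 /=.
  have -> : (0 <= t - r <= t) = (r <= t) by apply/andP/idP => [[]|]; lra.
  by case: ifP => // _; rewrite subr0 rnorm0.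
exists s'; split.
- move=> n _ /mapP[p /si [mp fp] ->] /=; split; first exact: mrI.
  by rewrite HrI lebesgue_measure_reflect//; exact: measurableI.
- move=> n; apply: (eq_measurable_fun (F n \o reflect_at t)).
    by move=> r; rewrite inE => Hr; rewrite /= FE.
  apply: measurable_funTS; apply: measurableT_comp (mF n) _.
  exact: measurable_reflect_at.
- apply: cvg_trans ds; apply: near_eq_cvg; apply: nearW => n.
  rewrite -(@ge0_integral_reflect t) //; last 2 first.
  + by apply/measurable_EFinP; exact: ms.
  + by move=> r _; rewrite lee_fin rnorm_ge0.
  rewrite rI [LHS]integral_mkcond [RHS]integral_mkcond.
  apply: eq_integral => r _; rewrite /patch.
  have [rI'|rI'] := boolP (r \in I).
    have Hr : H r by move: rI'; rewrite IE /H /= in_itv /= andbT => /andP[].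
    by rewrite mem_set// FE// /F /patch -[t - r]/(reflect_at t r)
       -[_ \in I]/(r \in _ @^-1` I) rI rI'.
  case: ifP => // /set_mem Hr; rewrite FE// /F /patch.
  by rewrite -[t - r]/(reflect_at t r) -[_ \in I]/(r \in _ @^-1` I) rI (negbTE rI').
- apply: cvg_trans cs; apply: near_eq_cvg; apply: nearW => n.
  rewrite /simple_integral big_map; apply: eq_big_seq => p /si[mp _].
  by rewrite /= HrI lebesgue_measure_reflect//; exact: measurableI.
Qed.

End Reflection.

(** A limit at [+oo] is tested on sequences tending to [+oo], to each of which dominated convergence
    applies. *)
Lemma dominated_cvg_pinfty d (T : measurableType d) (R : realType)
    (mu : {measure set T -> \bar R}) (D : set T) (f : R -> T -> \bar R)
    (F : T -> \bar R) :
  measurable D -> (forall t, measurable_fun D (f t)) -> mu.-integrable D F ->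
  (forall t x, 0 < t -> D x -> (0 <= f t x <= F x)%E) ->
  (forall x, D x -> f t x @[t --> +oo] --> 0%E) ->
  (\int[mu]_(x in D) f t x)%E @[t --> +oo] --> 0%E.
Proof.
move=> mD mf iF f0F f0.
have key (u : nat -> R) : u n @[n --> \oo] --> +oo -> (forall n, 0 < u n) ->
    (\int[mu]_(x in D) f (u n) x)%E @[n --> \oo] --> 0%E.
  move=> uy u0.
  have [] := @dominated_convergence _ _ _ mu _ mD (fun n => f (u n)) (cst 0%E) F.
  - by [].
  - exact: measurable_cst.
  - by apply: aeW => x Dx; exact: (cvg_comp _ _ uy (f0 x Dx)).
  - exact: iF.
  - by apply: aeW => x n Dx; have /andP[? ?] := f0F _ _ (u0 n) Dx; rewrite gee0_abs.
  - by rewrite integral0.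
(* The domination is assumed for positive parameters only, while a test sequence may start with
   others; the cutoff repairs this and is the identity from 1 on. *)
pose m1 (t : R) : R := Num.max t 1.
have m10 t : 0 < m1 t by rewrite lt_max ltr01 orbT.
pose G t := (\int[mu]_(x in D) f (m1 t) x)%E.
have G0 t : (0 <= G t)%E.
  apply: integral_ge0 => x Dx.
  by have /andP[] := f0F _ _ (m10 t) Dx.
have GF t : (G t <= \int[mu]_(x in D) F x)%E.
  apply: ge0_le_integral => //.
  - by move=> x Dx; have /andP[] := f0F _ _ (m10 t) Dx.
  - by case/integrableP: iF.
  - by move=> x Dx; have /andP[] := f0F _ _ (m10 t) Dx.
have Gfin t : G t \is a fin_num.
  rewrite ge0_fin_numE// (le_lt_trans (GF t))// ltey_eq.
  by rewrite integrable_fin_num.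
have Gcvg : fine (G t) @[t --> +oo] --> 0.
  apply/cvg_pinftyP => u uy.
  apply: fine_cvg; apply: key => //.
  apply/cvgryPge => A; near=> n; rewrite /m1 le_max; apply/orP; left.
  by near: n; exact: (cvgryPge _).1.
have GG : G t @[t --> +oo] --> 0%E by apply: cvg_EFin Gcvg; exact: nearW.
apply: cvg_trans GG; apply: near_eq_cvg; near=> t; rewrite /G.
suff -> : m1 t = t by [].
by apply/max_idPl; near: t; exact: nbhs_pinfty_ge.
Unshelve. all: by end_near. Qed.

(** * The integral of [alpha r ^ (alpha - 1) exp (- c r ^ alpha)] *)

Section PowerIntegral.
Context {R : realType}.
Implicit Types (alpha c p r : R).
Notation mu := (@lebesgue_measure R).

Lemma cvg_powR_pinfty p : 0 < p -> r `^ p @[r --> +oo] --> +oo.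
Proof.
move=> p0; apply/cvgryPge => A; near=> r.
pose B := Num.max A 0.
apply: (@le_trans _ _ B); first by rewrite le_max lexx.
have B0 : 0 <= B by rewrite le_max lexx orbT.
rewrite -[B]powRr1// -(mulVf (lt0r_neq0 p0)) powRrM.
apply: ge0_ler_powR; rewrite ?nnegrE ?powR_ge0 ?(ltW p0)//.
Unshelve. all: by end_near. Qed.

Lemma cvg_expR_powR c p : 0 < c -> 0 < p ->
  expR (- c * r `^ p) @[r --> +oo] --> 0.
Proof.
move=> c0 p0; under eq_fun do rewrite mulNr.
apply: (@cvg_comp _ _ _ (fun r => c * r `^ p) (fun x => expR (- x)));
  last exact: cvgr_expR.
apply/cvgryPge => A; near=> r; rewrite mulrC -ler_pdivrMr//.
by near: r; apply: (cvgryPge _).1; exact: cvg_powR_pinfty.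
Unshelve. all: by end_near. Qed.

Lemma continuous_powR p r : 0 < r -> {for r, continuous (fun x => x `^ p)}.
Proof.
move=> r0; apply: differentiable_continuous; apply/derivable1_diffP.
by apply: derivable_powR; rewrite in_itv /= andbT.
Qed.

(** The antiderivative [F] is [- exp (- c r ^ alpha) / c]. The integrand is singular at 0 when
    [alpha < 1], so the fundamental theorem is applied on [[1 / (n + 1), +oo[], where it gives at
    most [1 / c], and the bound passes to the increasing union. *)
Lemma integral_powR_expR_le alpha c : 0 < alpha -> 0 < c ->
  (\int[mu]_(r in `]0%R, +oo[)
     (alpha * r `^ (alpha - 1) * expR (- c * r `^ alpha))%:E <= (c^-1)%:E)%E.
Proof.
move=> a0 c0.
pose f r := alpha * r `^ (alpha - 1) * expR (- c * r `^ alpha).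
pose F r := - c^-1 * expR (- c * r `^ alpha).
have f0 r : 0 <= f r by rewrite !mulr_ge0 ?expR_ge0 ?powR_ge0// ltW.
have F' r : 0 < r -> is_derive r (1 : R) F (f r).
  move=> r0.
  have dG : is_derive r (1 : R) (fun r => - c * r `^ alpha)
      (- c * (alpha * r `^ (alpha - 1))).
    by have := @is_deriveZ R R R _ (- c) _ _ _ (is_derive1_powR alpha r0).
  have dE := @is_derive1_comp _ expR (fun r => - c * r `^ alpha) r _ _
    (is_derive_expR _) dG.
  have := @is_deriveZ R R R _ (- c^-1) _ _ _ dE.
  rewrite (_ : - c^-1 *: _ = f r)//.
  by rewrite /f /GRing.scale /=; field; rewrite gt_eqF.
have cf r : 0 < r -> {for r, continuous f}.
  move=> r0; apply: cvgM.
    by apply: cvgM; [exact: cvg_cst|exact: continuous_powR].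
  apply: (@cvg_comp _ _ _ (fun r => - c * r `^ alpha) expR); last exact: continuous_expR.
  by apply: cvgM; [exact: cvg_cst|exact: continuous_powR].
pose I n : set (measurableTypeR R) := `[n.+1%:R^-1, +oo[%classic.
have inv0 n : 0 < n.+1%:R^-1 :> R by [].
have mI n : measurable (I n) by exact: measurable_itv.
have FTC n : (\int[mu]_(r in I n) (f r)%:E <= (c^-1)%:E)%E.
  rewrite (@ge0_continuous_FTC2y _ f F _ 0).
  - rewrite -EFinB lee_fin sub0r /F mulNr opprK ler_piMr ?invr_ge0 ?(ltW c0)//.
    by rewrite -expR0 ler_expR mulNr oppr_le0 mulr_ge0 ?powR_ge0// ltW.
  - by [].
  - apply: continuous_in_subspaceT => r; rewrite inE /= in_itv /= andbT => nr.
    exact: cf (lt_le_trans (inv0 n) nr).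
  - rewrite -(mulr0 (- c^-1)); apply: cvgM; first exact: cvg_cst.
    exact: cvg_expR_powR.
  - by move=> r nr; have [] := F' r (lt_trans (inv0 n) nr).
  - apply: cvg_at_right_filter; apply: differentiable_continuous.
    by apply/derivable1_diffP; have [] := F' _ (inv0 n).
  - move=> r; rewrite in_itv /= andbT => nr.
    by rewrite derive1E; have [_] := F' r (lt_trans (inv0 n) nr).
have nd : nondecreasing_seq I.
  move=> m n mn; apply/subsetPset => r; rewrite /I /= !in_itv /= !andbT.
  by apply: le_trans; rewrite lef_pV2 ?posrE// ler_nat.
have -> : `]0, +oo[%classic = \bigcup_n I n.
  apply/seteqP; split=> r.
    rewrite /= in_itv /= andbT => r0.
    have [n _ /(_ n (leqnn n)) nr] := near_infty_natSinv_lt (PosNum r0).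
    by exists n => //; rewrite /I /= in_itv /= andbT ltW.
  by move=> [n _]; rewrite /I /= !in_itv /= !andbT; exact: lt_le_trans.
have mf n : measurable_fun (I n) (EFin \o f).
  apply/measurable_EFinP; apply: measurable_funTS; apply: measurable_funM.
    by apply: measurable_funM; [exact: measurable_cst|exact: measurable_powR].
  apply: measurableT_comp; first exact: measurable_expR.
  by apply: measurable_funM; [exact: measurable_cst|exact: measurable_powR].
have cI := @ge0_nondecreasing_set_cvg_integral _ _ _ I (EFin \o f) mu nd mI mf
  (fun n r _ => f0 r : (0 <= (f r)%:E)%E).
apply: (@cvge_to_le _ _ _ _ _ _ _ cI).
by apply: nearW => n; exact: FTC.
Unshelve. all: by end_near. Qed.

End PowerIntegral.

(** The kernel convolved with [f + eps] in the mild-solution formula; its Laplace transform is the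
    resolvent of [A] at [lambda ^ alpha]. *)
Definition caputo_kernel (R : realType) (X : completeNormedModType R[i])
    (alpha : R) (Phi : R -> R) (T : R -> {linear X -> X}) (r : R) (y : X) : X :=
  (r `^ (alpha - 1))%:C *: P_alpha alpha Phi T r y.

(** * Orbits of an exponentially stable semigroup and the kernel for [alpha < 1] *)

Section StableSemigroup.
Context {R : realType} {X : completeNormedModType R[i]}.
Variables (T : R -> {linear X -> X}) (a M : R).
Hypotheses (T_semigroup : C0_semigroup T) (a_gt0 : 0 < a) (M_gt0 : 0 < M).
Hypothesis T_le :
  forall t x, 0 <= t -> rnorm (T t x) <= M * expR (- a * t) * rnorm x.
Notation mu := (@lebesgue_measure R).
Notation H := (`]0, +oo[%classic : set (measurableTypeR R)).

Lemma semigroup_le t x : 0 <= t -> rnorm (T t x) <= M * rnorm x.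
Proof.
move=> t0; apply: (le_trans (T_le x t0)); rewrite ler_wpM2r ?rnorm_ge0//.
by rewrite ler_piMr ?(ltW M_gt0)// -expR0 ler_expR mulNr oppr_le0 mulr_ge0// ltW.
Qed.

(** Factoring [T t] through [T s] reduces continuity at any time to continuity at 0. *)
Lemma semigroup_dist_le s t x : 0 <= s -> s <= t ->
  rnorm (T s x - T t x) <= M * rnorm (T (t - s) x - x).
Proof.
move=> s0 st; have [_ _ TD _] := T_semigroup.
have -> : T t x = T s (T (t - s) x) by rewrite -TD ?subr_ge0// subrKC.
by rewrite -raddfB rdistC; exact: semigroup_le.
Qed.

Lemma scaled_semigroup_left_continuous c x (t e : R) : 0 < c -> 0 < t -> 0 < e ->
  exists2 delta, 0 < delta & forall s, 0 <= s -> s <= t -> t - s < delta ->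
    rnorm (s%:C *: T (c * s) x - t%:C *: T (c * t) x) < e.
Proof.
move=> c0 t0 e0; have [_ T0 _ Tx] := T_semigroup.
have tM : 0 <= t * M by rewrite mulr_ge0// ltW.
have Mx : 0 <= M * rnorm x by rewrite mulr_ge0 ?rnorm_ge0// ltW.
pose e1 := e / 2 / (t * M + 1).
have e10 : 0 < e1 by rewrite !divr_gt0// ltr_wpDl.
have [eta /= eta0 etaT] : exists2 eta : R, 0 < eta &
    forall h, 0 <= h -> h < eta -> rnorm (T h x - x) < e1.
  have /cvg_rnormP/(_ _ e10)[eta /= eta0 etaP] := Tx x.
  exists eta => // h; rewrite le_eqVlt => /predU1P[<-|h0] heta.
    by rewrite T0 subrr rnorm0.
  by apply: etaP => //=; rewrite sub0r normrN gtr0_norm.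
(* The first bound makes [c (t - s) < eta], which controls the increment of the orbit; the second
   controls [(s - t) T(c s) x]. Each contributes [e / 2]. *)
exists (Num.min (eta / c) (e / 2 / (M * rnorm x + 1))).
  by rewrite lt_min !divr_gt0// ltr_wpDl.
move=> s s0 st; rewrite lt_min => /andP[s1 s2].
have -> : s%:C *: T (c * s) x - t%:C *: T (c * t) x =
    (s - t)%:C *: T (c * s) x + t%:C *: (T (c * s) x - T (c * t) x).
  by rewrite rmorphB /= scalerBl scalerBr addrA subrK.
apply: (le_lt_trans (rnormD _ _)); rewrite !rnormZ (gtr0_norm t0).
have cs : c * s <= c * t by rewrite ler_pM2l.
have cs0 : 0 <= c * s by rewrite mulr_ge0// ltW.
rewrite [ltRHS](splitr e); apply: ltrD.
  rewrite distrC ger0_norm ?subr_ge0//.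
  apply: (@le_lt_trans _ _ ((t - s) * (M * rnorm x))).
    by rewrite ler_wpM2l ?subr_ge0// semigroup_le.
  apply: (@le_lt_trans _ _ ((t - s) * (M * rnorm x + 1))).
    by rewrite ler_wpM2l ?subr_ge0// lerDl.
  by rewrite -ltr_pdivlMr// ltr_wpDl.
have Th : rnorm (T (c * t - c * s) x - x) < e1.
  apply: etaT; first by rewrite subr_ge0.
  by rewrite -mulrBr mulrC -ltr_pdivlMr.
apply: (@le_lt_trans _ _ (t * (M * e1))).
  by rewrite ler_pM2l// (le_trans (semigroup_dist_le _ cs0 cs))// ler_pM2l// ltW.
apply: (@lt_le_trans _ _ ((t * M + 1) * e1)).
  by rewrite mulrA ltr_pM2r// ltrDl.
by rewrite /e1 mulrC divfK// gt_eqF// ltr_wpDl.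
Qed.

(** This is [z exp (- z) <= 1] at [z = a c t], a consequence of [1 + z <= exp z]. *)
Lemma scaled_semigroup_le c x t : 0 < c -> 0 <= t ->
  rnorm (t%:C *: T (c * t) x) <= M * rnorm x / (a * c).
Proof.
move=> c0 t0; have ac0 : 0 < a * c by rewrite mulr_gt0.
rewrite rnormZ_ge0//.
apply: (@le_trans _ _ (t * (M * expR (- a * (c * t)) * rnorm x))).
  by rewrite ler_wpM2l// T_le// mulr_ge0// ltW.
rewrite ler_pdivlMr//.
have -> : t * (M * expR (- a * (c * t)) * rnorm x) * (a * c) =
    M * rnorm x * ((a * c * t) * expR (- a * (c * t))) by ring.
apply: ler_piMr; first by rewrite mulr_ge0 ?rnorm_ge0// ltW.
rewrite mulNr expRN ler_pdivrMr ?expR_gt0// mul1r mulrA.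
by apply: le_trans (expR_ge1Dx _); rewrite lerDr.
Qed.

(** * Averaging the semigroup against the density [Phi] *)

Section Density.
Variables (alpha : R) (Phi : R -> R).
Hypotheses (alpha_gt0 : 0 < alpha) (alpha_lt1 : alpha < 1).
Hypothesis PhiP : is_Phi alpha Phi.

Let mPhi : measurable_fun H Phi. Proof. by case: PhiP. Qed.

Let Phi_ge0 s : 0 < s -> 0 <= Phi s. Proof. by case: PhiP => _ + _ _; exact. Qed.

Let HP (s : R) : H s = (0 < s) :> Prop. Proof. by rewrite /= in_itv /= andbT. Qed.

Let mH : measurable H. Proof. exact: measurable_itv. Qed.

Let integrable_Phi : mu.-integrable H (EFin \o Phi).
Proof.
apply/integrableP; split; first exact/measurable_EFinP.
rewrite (_ : (\int[mu]_(s in H) _)%E = 1%E); first exact: ltry.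
have [_ _ <- _] := PhiP; apply: eq_integral => s; rewrite inE HP => s0.
by rewrite gee0_abs// lee_fin Phi_ge0.
Qed.




(** The factor [s] is moved from the density to the vector: [Phi] is integrable, and [s T(c s) x] is
    bounded and left-continuous. *)
Lemma moment_bochner_integrable c x : 0 < c ->
  bochner_integrable mu H (fun s => (s * Phi s)%:C *: T (c * s) x).
Proof.
move=> c0.
rewrite (_ : (fun s => _) = (fun s => (Phi s)%:C *: (s%:C *: T (c * s) x))).
  apply: bochner_integrable_scale => //.
  - by move=> t; exact: scaled_semigroup_le.
  - by move=> t e; exact: scaled_semigroup_left_continuous.
by apply/funext => s; rewrite scalerA -rmorphM mulrC.
Qed.

Let moment c x : X := bochner_integral mu H (fun s => (s * Phi s)%:C *: T (c * s) x).

Let weight c (s : R) : R := s * Phi s * (M * expR (- a * (c * s))).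

Let weight_ge0 c s : H s -> 0 <= weight c s.
Proof.
rewrite HP => s0; have := Phi_ge0 s0.
by move=> p0; rewrite !mulr_ge0 ?expR_ge0// ltW.
Qed.

Let measurable_weight c : measurable_fun H (EFin \o weight c).
Proof.
apply/measurable_EFinP; apply: measurable_funM.
  exact: measurable_funM.
apply: measurable_funM; first exact: measurable_cst.
apply: measurable_funTS; apply: measurableT_comp; first exact: measurable_expR.
apply: measurable_funM; first exact: measurable_cst.
by apply: measurable_funM; [exact: measurable_cst|exact: measurable_id].
Qed.

(** Both moments are genuine integrals, so their difference is governed by the pointwise difference
    [T(c s) (y - z)], whose norm carries the weight. *)
Let moment_dist c y z : 0 < c ->
  ((rnorm (moment c y - moment c z))%:E <=
   \int[mu]_(s in H) (weight c s)%:E * (rnorm (y - z))%:E)%E.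
Proof.
move=> c0; rewrite -ge0_integralZr//; first last.
- by rewrite lee_fin rnorm_ge0.
- by move=> s Hs; rewrite lee_fin weight_ge0.
- exact: measurable_weight.
apply: (is_bochner_integral_rdist_le mH
  (bochner_integralP (moment_bochner_integrable y c0))
  (bochner_integralP (moment_bochner_integrable z c0))).
  by apply: emeasurable_funM; [exact: measurable_weight|exact: measurable_cst].
move=> s Hs; move: (Hs); rewrite HP => s0; have p0 := Phi_ge0 s0.
rewrite -scalerBr -raddfB rnormZ_ge0 ?mulr_ge0 ?(ltW s0)// -EFinM lee_fin.
rewrite /weight -[leRHS]mulrA ler_wpM2l ?mulr_ge0 ?(ltW s0)//.
by rewrite T_le// mulr_ge0 ?(ltW c0) ?(ltW s0).
Qed.

Let moment0 c : moment c 0 = 0.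
Proof.
apply: bochner_integralE => //.
rewrite (_ : (fun s => _) = cst 0); first exact: is_bochner_integral0.
by apply/funext => s; rewrite linear0 scaler0.
Qed.

(** With [(r, s) = p], this bounds the operator norm of [alpha r ^ (alpha - 1) s Phi(s) T(r ^ alpha
    s)], extended by 0 off the open quadrant so that Tonelli's theorem applies on the whole plane.
    The grouping isolates the integrand of [integral_powR_expR_le] with [c = a s]. *)
Let Psi (p : measurableTypeR R * measurableTypeR R) : R :=
  \1_H p.1 * (alpha * p.1 `^ (alpha - 1) * expR (- (a * p.2) * p.1 `^ alpha)) *
  (M * (p.2 * (Phi \_ H) p.2)).

Let Psi_ge0 p : 0 <= Psi p.
Proof.
rewrite /Psi mulr_ge0//.
  by rewrite mulr_ge0 ?indic_ge0// !mulr_ge0 ?expR_ge0 ?powR_ge0// ltW.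
rewrite mulr_ge0 ?(ltW M_gt0)// /patch; case: ifPn => [|_]; last by rewrite mulr0.
by rewrite inE HP => s0; rewrite mulr_ge0 ?(ltW s0)// Phi_ge0.
Qed.

Let measurable_Psi : measurable_fun setT (EFin \o Psi).
Proof.
have m1 p : measurable_fun setT (fun q : measurableTypeR R * measurableTypeR R =>
    q.1 `^ p).
  by apply: (measurableT_comp (measurable_powR p)); exact: measurable_fst.
apply/measurable_EFinP; apply: measurable_funM.
  apply: measurable_funM.
    apply: (measurableT_comp (measurable_indic mH)); exact: measurable_fst.
  apply: measurable_funM.
    by apply: measurable_funM; [exact: measurable_cst|exact: m1].
  apply: measurableT_comp; first exact: measurable_expR.
  apply: measurable_funM; last exact: m1.
  apply: measurableT_comp => //.
  by apply: measurable_funM; [exact: measurable_cst|exact: measurable_snd].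
apply: measurable_funM; first exact: measurable_cst.
apply: measurable_funM; first exact: measurable_snd.
apply: (@measurableT_comp _ _ _ _ _ _ (Phi \_ H)); last exact: measurable_snd.
by apply/(measurable_restrictT _ mH).
Qed.

Let kappa (r : R) : \bar R := (\int[mu]_s (Psi (r, s))%:E)%E.

Let kappaE r : 0 < r ->
  kappa r = ((alpha * r `^ (alpha - 1))%:E *
             \int[mu]_(s in H) (weight (r `^ alpha) s)%:E)%E.
Proof.
move=> r0; rewrite /kappa -ge0_integralZl//; first last.
- by rewrite lee_fin mulr_ge0 ?powR_ge0// ltW.
- by move=> s Hs; rewrite lee_fin weight_ge0.
- exact: measurable_weight.
rewrite [RHS]integral_mkcond; apply: eq_integral => s _; rewrite /Psi /patch /=.
have -> : \1_H r = 1 :> R by rewrite indicE mem_set// HP.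
case: ifPn => Hs; last by rewrite !mulr0.
rewrite -EFinM; congr (_%:E); rewrite /weight.
have -> : - (a * s) * r `^ alpha = - a * (r `^ alpha * s) by ring.
ring.
Qed.

Let integral_kappa : (\int[mu]_r kappa r < +oo)%E.
Proof.
rewrite /kappa.
rewrite (@fubini_tonelli _ _ _ _ _ mu mu (EFin \o Psi) measurable_Psi); last first.
  by move=> p; rewrite lee_fin.
apply: (@le_lt_trans _ _ (\int[mu]_(s in H) ((M / a)%:E * (Phi s)%:E))%E).
  rewrite [leRHS]integral_mkcond; apply: ge0_le_integral => //.
  - by move=> s _; apply: integral_ge0 => r _; rewrite lee_fin.
  - by apply: measurable_fun_fubini_tonelli_G => // p; rewrite lee_fin.
  - apply/(measurable_restrictT _ mH); apply: emeasurable_funM.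
      exact: measurable_cst.
    exact/measurable_EFinP.
  move=> s _; rewrite /patch; case: ifPn => Hs; last first.
    rewrite /fubini_G integral0_eq// => r _.
    by rewrite /= /Psi /patch /= (negbTE Hs) !mulr0.
  move: (Hs); rewrite inE HP => s0; have p0 := Phi_ge0 s0.
  have as0 : 0 < a * s by rewrite mulr_gt0.
  rewrite /fubini_G (_ : (\int[mu]_x _)%E = (\int[mu]_(r in H)
    ((alpha * r `^ (alpha - 1) * expR (- (a * s) * r `^ alpha))%:E *
     (M * (s * Phi s))%:E))%E); last first.
    rewrite [RHS]integral_mkcond; apply: eq_integral => r _.
    rewrite /= /Psi /patch /= Hs indicE; case: ifPn => _.
      by rewrite mul1r.
    by rewrite !mul0r.
  rewrite ge0_integralZr//; first last.
  - by rewrite lee_fin !mulr_ge0// ltW.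
  - by move=> r _; rewrite lee_fin !mulr_ge0 ?expR_ge0 ?powR_ge0// ltW.
  - apply/measurable_EFinP; apply: measurable_funTS; apply: measurable_funM.
      by apply: measurable_funM; [exact: measurable_cst|exact: measurable_powR].
    apply: measurableT_comp; first exact: measurable_expR.
    by apply: measurable_funM; [exact: measurable_cst|exact: measurable_powR].
  (* The two factors [s] cancel, leaving [(M / a) Phi s]. *)
  apply: (@le_trans _ _ (((a * s)^-1)%:E * (M * (s * Phi s))%:E)%E).
    apply: lee_wpmul2r; first by rewrite lee_fin !mulr_ge0// ltW.
    exact: integral_powR_expR_le.
  by rewrite -!EFinM lee_fin le_eqVlt; apply/orP; left; apply/eqP; field; rewrite !gt_eqF.
rewrite ge0_integralZl//; first last.
- by rewrite lee_fin divr_ge0// ltW.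
- by move=> s; rewrite HP => s0; rewrite lee_fin Phi_ge0.
- exact/measurable_EFinP.
by have [_ _ -> _] := PhiP; rewrite mule1 ltry.
Qed.

Lemma caputo_kernel_majorant :
  exists kap : R -> \bar R,
  [/\ measurable_fun [set: measurableTypeR R] kap, forall r, (0 <= kap r)%E,
      (\int[mu]_(r in `[0%R, +oo[) kap r < +oo)%E,
      (forall r y z, 0 <= r ->
        ((rnorm (caputo_kernel alpha Phi T r y - caputo_kernel alpha Phi T r z))%:E
          <= kap r * (rnorm (y - z))%:E)%E) &
      forall r, 0 <= r -> caputo_kernel alpha Phi T r 0 = 0].
Proof.
have k0 r : (0 <= kappa r)%E by apply: integral_ge0 => s _; rewrite lee_fin.
have mk : measurable_fun [set: measurableTypeR R] kappa.
  by apply: (measurable_fun_fubini_tonelli_F (EFin \o Psi)) => // p; rewrite lee_fin.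
have KE r y : caputo_kernel alpha Phi T r y =
    (r `^ (alpha - 1) * alpha)%:C *: moment (r `^ alpha) y.
  by rewrite /caputo_kernel /P_alpha lt_eqF// scalerA -rmorphM.
exists kappa; split=> //.
- by apply: le_lt_trans integral_kappa; apply: ge0_subset_integral.
- move=> r y z; rewrite !KE -scalerBr le_eqVlt => /predU1P[<-|r0].
    (* At [r = 0] the convention [0 ^ p = 0] for nonzero [p] makes the kernel vanish, since
       [alpha - 1] is not 0. *)
    rewrite powR0 ?mul0r ?scale0r ?rnorm0 ?mule_ge0 ?lee_fin ?rnorm_ge0//.
    by rewrite subr_eq0 lt_eqF.
  have ra : 0 <= r `^ (alpha - 1) * alpha by rewrite mulr_ge0 ?powR_ge0// ltW.
  rewrite rnormZ_ge0// kappaE// EFinM [in leRHS]mulrC -muleA.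
  by apply: lee_wpmul2l; [rewrite lee_fin|apply: moment_dist; exact: powR_gt0].
- by move=> r _; rewrite KE moment0 scaler0.
Qed.

End Density.
End StableSemigroup.

(** * Decay of [S_alpha] and asymptotic periodicity of convolutions *)

Section AsymptoticPeriodicity.
Context {R : realType} {X : completeNormedModType R[i]}.
Implicit Types (T : R -> {linear X -> X}) (alpha : R) (Phi : R -> R).
Notation mu := (@lebesgue_measure R).

(** For [alpha < 1], the integrand is dominated by [M |x| Phi s] and, at each [s > 0], tends to 0
    like [exp (- a s t ^ alpha)]. *)
Lemma S_alpha_cvg0 T alpha Phi x : 0 < alpha -> alpha <= 1 ->
  (alpha < 1 -> is_Phi alpha Phi) -> exponentially_stable T ->
  S_alpha alpha Phi T t x @[t --> +oo] --> 0.
Proof.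
move=> alpha0; rewrite le_eqVlt => /predU1P[->|alpha1] PhiP [a [M [a0 M0 TM]]].
  rewrite /S_alpha eqxx.
  apply/cvg_rnormP => e e0.
  (* The exponent 1 is written out to match [cvg_expR_powR]. *)
  have : (M * expR (- a * t `^ 1) * rnorm x) @[t --> +oo] --> M * 0 * rnorm x.
    by apply: cvgM; [apply: cvgM; [exact: cvg_cst|exact: cvg_expR_powR]|exact: cvg_cst].
  rewrite mulr0 mul0r => /cvgrPdist_lt/(_ _ e0) Me; near=> t.
  rewrite subr0; have t0 : 0 <= t by near: t; exact: nbhs_pinfty_ge.
  apply: (le_lt_trans (TM t x t0)).
  have : `|0 - M * expR (- a * t `^ 1) * rnorm x| < e by near: t; exact: Me.
  by rewrite powRr1// sub0r normrN; apply: le_lt_trans; exact: ler_norm.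
have [mPhi Phi0 intPhi _] := PhiP alpha1.
pose H : set (measurableTypeR R) := `]0, +oo[%classic.
have mH : measurable H by exact: measurable_itv.
have HP s : H s -> 0 < s by rewrite /H /= in_itv /= andbT.
pose h t s := (Phi s * (M * expR (- a * (t `^ alpha * s)) * rnorm x))%:E.
have mexp t : measurable_fun H (fun s : measurableTypeR R => expR (- a * (t `^ alpha * s))).
  apply: measurable_funTS; apply: measurableT_comp; first exact: measurable_expR.
  apply: measurable_funM; first exact: measurable_cst.
  by apply: measurable_funM; [exact: measurable_cst|exact: measurable_id].
have mh t : measurable_fun H (h t).
  apply/measurable_EFinP; apply: measurable_funM => //.
  apply: measurable_funM; last exact: measurable_cst.
  by apply: measurable_funM; first exact: measurable_cst.
have Sh t : ((rnorm (S_alpha alpha Phi T t x))%:E <= \int[mu]_(s in H) h t s)%E.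
  rewrite /S_alpha lt_eqF//; apply: rnorm_bochner_integral_le => // s Hs.
  have s0 := HP _ Hs.
  rewrite lee_fin rnormZ_ge0 ?Phi0// ler_wpM2l ?Phi0//.
  by rewrite TM// mulr_ge0 ?powR_ge0// ltW.
have h0 : (\int[mu]_(s in H) h t s)%E @[t --> +oo] --> 0%E.
  apply: (@dominated_cvg_pinfty _ _ _ mu H h
    (fun s => (M * rnorm x)%:E * (Phi s)%:E)%E) => //.
  - apply: integrableZl => //; apply/integrableP; split; first exact/measurable_EFinP.
    rewrite (_ : (\int[mu]_(s in H) _)%E = 1%E); first exact: ltry.
    rewrite -intPhi; apply: eq_integral => s; rewrite inE => /HP s0.
    by rewrite gee0_abs// lee_fin Phi0.
  - move=> t s t0 /HP s0; rewrite -EFinM !lee_fin; apply/andP; split.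
      by rewrite !mulr_ge0 ?expR_ge0 ?rnorm_ge0 ?Phi0// ltW.
    rewrite [leRHS]mulrC ler_wpM2l ?Phi0// ler_wpM2r ?rnorm_ge0//.
    rewrite ler_piMr ?(ltW M0)// -expR0 ler_expR mulNr oppr_le0.
    by rewrite !mulr_ge0 ?powR_ge0// ltW.
  - move=> s /HP s0; apply: cvg_EFin; first exact: nearW.
    have : (Phi s * (M * expR (- (a * s) * t `^ alpha) * rnorm x)) @[t --> +oo]
        --> Phi s * (M * 0 * rnorm x).
      apply: cvgM; first exact: cvg_cst.
      apply: cvgM; last exact: cvg_cst.
      apply: cvgM; first exact: cvg_cst.
      by apply: cvg_expR_powR => //; rewrite mulr_gt0.
    rewrite mulr0 mul0r mulr0; apply: cvg_trans.
    apply: near_eq_cvg; apply: nearW => t; rewrite /h /=.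
    by have -> : - (a * s) * t `^ alpha = - a * (t `^ alpha * s) by ring.
have hge0 t : (0 <= \int[mu]_(s in H) h t s)%E.
  by apply: (le_trans _ (Sh t)); rewrite lee_fin rnorm_ge0.
apply/cvg_rnormP => e e0.
have e2 : 0 < e / 2 by rewrite divr_gt0.
have /ge0_cvge0P-/(_ hge0)/(_ _ e2) he := h0; near=> t.
rewrite subr0; apply: (@le_lt_trans _ _ (e / 2)); last by lra.
by rewrite -lee_fin (le_trans (Sh t))//; near: t; exact: he.
Unshelve. all: by end_near. Qed.

(** For [alpha = 1] the kernel is the semigroup itself, with majorant [M exp (- a r)]; its integral
    is the case [alpha = 1], [c = a] of [integral_powR_expR_le]. The difference estimate and the
    value at 0 are all that the convolution argument asks of the kernel. *)
Lemma kernel_majorant T alpha Phi : 0 < alpha -> alpha <= 1 ->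
  (alpha < 1 -> is_Phi alpha Phi) -> C0_semigroup T -> exponentially_stable T ->
  exists kap : R -> \bar R,
  [/\ measurable_fun [set: measurableTypeR R] kap, forall r, (0 <= kap r)%E,
      (\int[mu]_(r in `[0%R, +oo[) kap r < +oo)%E,
      (forall r y z, 0 <= r ->
        ((rnorm (caputo_kernel alpha Phi T r y - caputo_kernel alpha Phi T r z))%:E
          <= kap r * (rnorm (y - z))%:E)%E) &
      forall r, 0 <= r -> caputo_kernel alpha Phi T r 0 = 0].
Proof.
move=> alpha0; rewrite le_eqVlt => /predU1P[->|alpha1] PhiP Tsg [a [M [a0 M0 TM]]]; last first.
  exact: (caputo_kernel_majorant Tsg a0 M0 TM alpha0 alpha1 (PhiP alpha1)).
have mexp : measurable_fun [set: measurableTypeR R] (fun r => (M * expR (- a * r))%:E).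
  apply/measurable_EFinP; apply: measurable_funM; first exact: measurable_cst.
  apply: measurableT_comp; first exact: measurable_expR.
  by apply: measurable_funM; [exact: measurable_cst|exact: measurable_id].
have KE r y : caputo_kernel 1 Phi T r y = T r y.
  by rewrite /caputo_kernel subrr powRr0 scale1r /P_alpha eqxx.
exists (fun r => (M * expR (- a * r))%:E); split=> //.
- by move=> r; rewrite lee_fin mulr_ge0 ?expR_ge0// ltW.
- rewrite -integral_itv_obnd_cbnd; last exact: measurable_funTS.
  apply: (@le_lt_trans _ _ (M%:E * (a^-1)%:E)%E); last by rewrite -EFinM ltry.
  under eq_integral do rewrite EFinM.
  rewrite ge0_integralZl//; first last.
  + by rewrite lee_fin ltW.
  + apply/measurable_EFinP; apply: measurable_funTS.
    apply: measurableT_comp; first exact: measurable_expR.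
    by apply: measurable_funM; [exact: measurable_cst|exact: measurable_id].
  apply: lee_wpmul2l; first by rewrite lee_fin ltW.
  apply: le_trans (integral_powR_expR_le (@ltr01 R) a0).
  rewrite le_eqVlt; apply/orP; left; apply/eqP; apply: eq_integral => r.
  rewrite inE /= in_itv /= andbT => r0.
  by rewrite subrr powRr0 !mul1r powRr1// ltW.
- by move=> r y z r0; rewrite !KE -raddfB -EFinM lee_fin TM.
- by move=> r _; rewrite KE linear0.
Qed.

Lemma cvg_addr1_pinfty : (t : R) + 1 @[t --> +oo] --> +oo.
Proof.
apply/cvgryPge => A; near=> t; rewrite -lerBlDr.
by near: t; apply: nbhs_pinfty_ge; rewrite num_real.
Unshelve. all: by end_near. Qed.

Lemma convolution_asymptotic_1_periodic (K : R -> X -> X) (kap : R -> \bar R)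
    (S g u : R -> X) (C : R) :
  measurable_fun [set: measurableTypeR R] kap -> (forall r, (0 <= kap r)%E) ->
  (\int[mu]_(r in `[0%R, +oo[) kap r < +oo)%E ->
  (forall r y z, 0 <= r ->
    ((rnorm (K r y - K r z))%:E <= kap r * (rnorm (y - z))%:E)%E) ->
  (forall r, 0 <= r -> K r 0 = 0) ->
  S t @[t --> +oo] --> 0 ->
  (forall s, 0 <= s -> rnorm (g s) <= C) -> asymptotic_1_periodic g ->
  (forall t, 0 <= t ->
    is_bochner_integral mu `[0, t] (fun s => K (t - s) (g s)) (u t - S t)) ->
  asymptotic_1_periodic u.
Proof.
move=> mkap kap0 ikap kapP K0 Scvg gC g1 uE.
have C0 : 0 <= C by apply: le_trans (gC 0 (lexx _)); exact: rnorm_ge0.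
have Kkap r y : 0 <= r -> ((rnorm (K r y))%:E <= kap r * (rnorm y)%:E)%E.
  by move=> r0; have := kapP r y 0 r0; rewrite K0// !subr0.
pose H : set (measurableTypeR R) := `[0, +oo[%classic.
have mH : measurable H by exact: measurable_itv.
have HP r : H r -> 0 <= r by rewrite /H /= in_itv /= andbT.
have conv t : 0 <= t -> is_bochner_integral mu H
    (fun r => if r <= t then K r (g (t - r)) else 0) (u t - S t).
  move=> t0.
  have gE : (fun r => if r <= t then K (t - (t - r)) (g (t - r)) else 0) =
      (fun r => if r <= t then K r (g (t - r)) else 0).
    by apply/funext => r; rewrite subKr.
  by rewrite -gE; exact: (is_bochner_integral_reflect (uE t t0)).
(* The range [r > t - N] collects two defects: for [r] in []t - N, t]] the increment of [g] at
   [t - r < N] need not be small, and for [r] in []t, t + 1]] only the integral at [t + 1] has a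
   nonzero integrand. The factor [2 C] covers both, and the range recedes to infinity with [t]. *)
pose tail N t r := (kap r * (2 * C * \1_[set s | t - N < s] r)%:E)%E.
have tail_ge0 N t r : (0 <= tail N t r)%E.
  by rewrite mule_ge0// lee_fin !mulr_ge0.
have mtail N t : measurable_fun H (tail N t).
  apply: emeasurable_funM; first exact: measurable_funTS.
  apply/measurable_EFinP; apply: measurable_funM; first exact: measurable_cst.
  apply: measurable_funTS; apply: measurable_indic.
  by rewrite -[X in measurable X]set_itvoy; exact: measurable_itv.
have ikapH : mu.-integrable H kap.
  apply/integrableP; split; first exact: measurable_funTS.
  by under eq_integral do rewrite gee0_abs//.
have tail_cvg N : (\int[mu]_(r in H) tail N t r)%E @[t --> +oo] --> 0%E.
  apply: (@dominated_cvg_pinfty _ _ _ mu H (tail N)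
    (fun r => (2 * C)%:E * kap r)%E) => //.
  - exact: integrableZl.
  - move=> t r _ _; rewrite tail_ge0 /tail muleC lee_wpmul2r// lee_fin.
    by rewrite ler_piMr ?mulr_ge0// indicE; case: (_ \in _).
  - move=> r _; apply: cvg_near_cst; near=> t; rewrite /tail indicE memNset/=.
      by rewrite mulr0 mule0.
    by apply/negP; rewrite -leNgt lerBrDr; near: t; apply: nbhs_pinfty_ge; rewrite num_real.
have main t N e : 0 <= t -> 0 <= N -> 0 <= e ->
    (forall s, N <= s -> rnorm (g (s + 1) - g s) <= e) ->
    ((rnorm ((u (t + 1) - S (t + 1)) -
             (u t - S t)))%:E <=
     e%:E * \int[mu]_(r in H) kap r + \int[mu]_(r in H) tail N t r)%E.
  move=> t0 N0 e0 ge.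
  rewrite -ge0_integralZl//; last exact: measurable_funTS.
  rewrite -ge0_integralD//; first last.
  - by apply: emeasurable_funM; [exact: measurable_cst|exact: measurable_funTS].
  - by move=> r _; rewrite mule_ge0.
  have t10 : 0 <= t + 1 by rewrite addr_ge0.
  apply: (is_bochner_integral_rdist_le mH (conv _ t10) (conv _ t0)).
    apply: emeasurable_funD => //.
    by apply: emeasurable_funM; [exact: measurable_cst|exact: measurable_funTS].
  move=> r /HP r0.
  have ekap : (0 <= e%:E * kap r)%E by rewrite mule_ge0.
  have [rt|tr] := leP r t.
    have -> : r <= t + 1 by rewrite (le_trans rt)// lerDl.
    apply: (le_trans (kapP _ _ _ r0)).
    have tr0 : 0 <= t - r by rewrite subr_ge0.
    have -> : t + 1 - r = t - r + 1 by rewrite addrAC.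
    have [Ntr|trN] := leP N (t - r).
      rewrite [leLHS]muleC -[leLHS]adde0 leeD// lee_wpmul2r// lee_fin.
      exact: ge.
    rewrite -[leLHS]add0e leeD// /tail lee_wpmul2l// lee_fin.
    rewrite indicE mem_set/=; last by rewrite ltrBlDr -ltrBlDl.
    rewrite mulr1 mulr2n mulrDl mul1r (le_trans (rnormB _ _))// lerD// gC//.
    by rewrite addr_ge0.
  case: ifPn => [rt1|_]; last by rewrite subr0 rnorm0 adde_ge0.
  rewrite subr0; apply: (le_trans (Kkap _ _ r0)).
  rewrite -[leLHS]add0e leeD// /tail lee_wpmul2l// lee_fin.
  rewrite indicE mem_set/=; last by rewrite (le_lt_trans _ tr)// lerBlDr lerDl.
  rewrite mulr1 (le_trans (gC _ _)) ?subr_ge0//.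
  by rewrite mulr2n mulrDl mul1r lerDl.
have fkap : (\int[mu]_(r in H) kap r)%E \is a fin_num.
  by rewrite ge0_fin_numE// integral_ge0.
pose k := fine (\int[mu]_(r in H) kap r)%E.
have k0 : 0 <= k by rewrite fine_ge0// integral_ge0.
apply/cvg_rnormP => e e0; have e4 : 0 < e / 4 by rewrite divr_gt0.
(* One quarter of [e] each goes to the increments of [g] weighted by [k], the tail, [S t] and
   [S (t + 1)]; the [+ 1] allows for [k = 0]. *)
have e4k : 0 < e / 4 / (k + 1) by rewrite divr_gt0// ltr_wpDl.
have [N0 [_ gN0]] := (cvg_rnormP _ _).1 g1 _ e4k.
(* The neighbourhood of [+oo] gives the bound for [s > N0] strictly, whence [N0 + 1]; nonnegativity
   of [N] puts all of [r > t] in the tail. *)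
pose N := Num.max (N0 + 1) 0.
have N_ge0 : 0 <= N by rewrite le_max lexx orbT.
have gN s : N <= s -> rnorm (g (s + 1) - g s) <= e / 4 / (k + 1).
  move=> Ns; rewrite -[_ - _]subr0 ltW//; apply: gN0.
  by rewrite (lt_le_trans _ Ns)// lt_max ltrDl ltr01.
have tail0 t : (0 <= \int[mu]_(r in H) tail N t r)%E by exact: integral_ge0.
have /ge0_cvge0P-/(_ tail0)/(_ _ e4) taile := tail_cvg N.
have Se := (cvg_rnormP _ _).1 Scvg _ e4.
have S1e := (cvg_rnormP _ _).1 (cvg_comp _ _ cvg_addr1_pinfty Scvg) _ e4.
near=> t; rewrite subr0.
have t0 : 0 <= t by near: t; exact: nbhs_pinfty_ge.
have St : rnorm (S t - 0) < e / 4 by near: t; exact: Se.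
have S1t : rnorm (S (t + 1) - 0) < e / 4 by near: t; exact: S1e.
rewrite !subr0 in St S1t.
have te : (\int[mu]_(r in H) tail N t r <= (e / 4)%:E)%E by near: t; exact: taile.
have := le_trans (main t N _ t0 N_ge0 (ltW e4k) gN) (leeD2l _ te).
rewrite -[X in (_ * X)%E]fineK// -/k -EFinM -EFinD lee_fin => dle.
have ke : e / 4 / (k + 1) * k <= e / 4.
  by rewrite -mulrA ler_piMr ?(ltW e4)// mulrC ler_pdivrMr ?ltr_wpDl// mul1r lerDl.
have -> : u (t + 1) - u t = ((u (t + 1) - S (t + 1)) -
    (u t - S t)) +
    (S (t + 1) - S t).
  by rewrite opprB [RHS]addrACA subrK (addrAC _ (- u t)) subrr add0r.
apply: (le_lt_trans (rnormD _ _)).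
have := rnormB (S (t + 1)) (S t).
by move: dle ke St S1t; lra.
Unshelve. all: by end_near. Qed.

Lemma asymptotic_mild_solution_periodic T alpha Phi (f u : R -> X) :
  0 < alpha -> alpha <= 1 -> (alpha < 1 -> is_Phi alpha Phi) ->
  C0_semigroup T -> exponentially_stable T ->
  BUC f -> asymptotic_1_periodic f ->
  asymptotic_mild_solution alpha Phi T f u -> asymptotic_1_periodic u.
Proof.
move=> alpha0 alpha1 PhiP Tsg Tst [[Mf fM] _] f1.
move=> [_ [x [eps [[[[Me epsM] _] eps0] uE]]]].
have [kap [mkap kap0 ikap kapP K0]] := kernel_majorant alpha0 alpha1 PhiP Tsg Tst.
apply: (@convolution_asymptotic_1_periodic (caputo_kernel alpha Phi T) kap
  (fun t => S_alpha alpha Phi T t x) (fun s => f s + eps s) u (Mf + Me)) => //.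
- exact: S_alpha_cvg0.
- by move=> s s0; rewrite (le_trans (rnormD _ _))// lerD ?fM ?epsM.
(* The increment of [eps] tends to 0 because [eps] does, so adding it to [f] preserves asymptotic
   periodicity. *)
- rewrite /asymptotic_1_periodic.
  rewrite (_ : (fun t => _) = (fun t => (f (t + 1) - f t) + (eps (t + 1) - eps t))).
    rewrite -(addr0 0) -[X in _ + X](subr0 0).
    apply: cvgD => //; apply: cvgB => //.
    exact: (cvg_comp _ _ cvg_addr1_pinfty eps0).
  by apply/funext => t; rewrite opprD addrACA.
- move=> t t0; have [ki ->] := uE t t0.
  by rewrite addrC addKr; exact: bochner_integralP ki.
Qed.

End AsymptoticPeriodicity.

Unset Implicit Arguments.

Theorem theorem3p16 (R : realType) (X : completeNormedModType R[i])
  (alpha : R) (Phi : R -> R) (A : operator X) (T : R -> {linear X -> X})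
  (f : R -> X)
  (alpha_gt0 : 0 < alpha) (alpha_le1 : alpha <= 1)
  (PhiP : alpha < 1 -> is_Phi alpha Phi)
  (A_linear : linear_operator A) (A_closed : closed_operator A)
  (T_semigroup : C0_semigroup T) (A_generates : generates A T)
  (T_stable : exponentially_stable T)
  (A_resolvent : [set cpow lambda alpha | lambda in
     [set lambda : Cplane R | 0 < complex.Re lambda]] `<=` resolvent_set A)
  (Sigma_closed : closed (cexp @` Sigma_i A alpha `\` [set (1 : Cplane R)]))
  (f_BUC : BUC f) (f_periodic : asymptotic_1_periodic f) :
  (exists u : R -> X, asymptotic_mild_solution alpha Phi T f u /\
                      asymptotic_1_periodic u) <->
  (exists u : R -> X, asymptotic_mild_solution alpha Phi T f u).
Proof.
split=> [[u [u_sol _]]|[u u_sol]]; exists u => //; split=> //.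
exact: (asymptotic_mild_solution_periodic alpha_gt0 alpha_le1 PhiP T_semigroup
  T_stable f_BUC f_periodic u_sol).
Qed.
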